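(* Let $F \in \mathbb{C}[x_0,\dots,x_n]$ be a homogeneous polynomial of degree $d$. Let $c \geq 0$ and $s \geq 2$ be integers, and suppose that the hypersurface $\operatorname{Z}(F)\subseteq\mathbb{P}^n$ contains no irreducible subvariety $X$ with $\operatorname{codim} X \leq c$ and $\deg X < s$. Then $\operatorname{sr}(F) \geq c+1$, and for every integer $k$ with $2 \le k \le d-1$, \[ \operatorname{str}_k(F) \geq \min\{c+1, \lceil \log_k s \rceil\}. \]
   Context: $\operatorname{Z}(F)$ denotes the zero set of $F$ in complex projective space $\mathbb{P}^n$; codimension of a subvariety $X\subseteq \mathbb{P}^n$ is $n-\dim X$, and $\deg X$ is the usual degree of a projective variety. The slice rank $\operatorname{sr}(F)$ is the minimal $r$ such that $F=\sum_{i=1}^r L_i H_i$ with $L_i$ linear forms and $H_i$ homogeneous polynomials. For $1\le k<d$, $\operatorname{str}_k(F)$ is the minimal $r$ such that $F=\sum_{i=1}^r G_i H_i$ with $G_i,H_i$ homogeneous of degree less than $d$ and $\deg G_i = k$ for all $i$.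
   Formalization: The formal statement assumes n ≥ 1; for n = 0 the claim fails, since Z(x_0^d) in P^0 is empty, so the hypothesis holds for every c while sr(x_0^d) = 1. *)

(* Defs.v *)
From mathcomp Require Import all_boot all_order all_algebra.
From mathcomp Require Import complex mpoly.
From mathcomp Require Import boolp classical_sets reals.

Set Implicit Arguments.
Unset Strict Implicit.
Unset Printing Implicit Defensive.

Import Order.TTheory GRing.Theory Num.Theory.
Local Open Scope ring_scope.
Local Open Scope classical_set_scope.

Definition is_minimum (P : nat -> Prop) (r : nat) : Prop :=
  P r /\ forall m, P m -> (r <= m)%N.

Definition is_maximum (P : nat -> Prop) (r : nat) : Prop :=
  P r /\ forall m, P m -> (m <= r)%N.

Definition homogeneous (K : fieldType) (n : nat) (f : {mpoly K[n.+1]}) : Prop :=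
  exists e : nat, f \is e.-homog.

(* A point of P^n is a line through the origin of K^(n+1). *)
Definition pspace (K : fieldType) (n : nat) : Type :=
  {L : {vspace 'rV[K]_n.+1} | \dim L == 1%N}.

Definition vanishes_at (K : fieldType) (n : nat)
    (f : {mpoly K[n.+1]}) (p : pspace K n) : Prop :=
  forall v : 'rV[K]_n.+1, v \in val p -> f.@[v ord0] = 0.

Definition zero_locus (K : fieldType) (n : nat)
    (T : set {mpoly K[n.+1]}) : set (pspace K n) :=
  [set p | forall f, T f -> vanishes_at f p].

Definition hypersurface (K : fieldType) (n : nat)
    (f : {mpoly K[n.+1]}) : set (pspace K n) :=
  zero_locus [set f].

Definition zariski_closed (K : fieldType) (n : nat)
    (X : set (pspace K n)) : Prop :=
  exists2 T : set {mpoly K[n.+1]},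
    (forall f, T f -> homogeneous f) & X = zero_locus T.

Definition irreducible_subvariety (K : fieldType) (n : nat)
    (X : set (pspace K n)) : Prop :=
  [/\ zariski_closed X, X !=set0 &
      forall A B : set (pspace K n), zariski_closed A -> zariski_closed B ->
        X = A `|` B -> X = A \/ X = B].

(* W 0, ..., W l is a strictly increasing chain of irreducible closed subsets
   of X; the values of W beyond l are irrelevant. *)
Definition irreducible_chain (K : fieldType) (n : nat)
    (X : set (pspace K n)) (l : nat) : Prop :=
  exists W : nat -> set (pspace K n),
    (forall i, (i <= l)%N -> irreducible_subvariety (W i) /\ W i `<=` X) /\
    (forall i, (i < l)%N -> W i `<` W i.+1).

Definition is_dim (K : fieldType) (n : nat)
    (X : set (pspace K n)) (r : nat) : Prop :=
  is_maximum (irreducible_chain X) r.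

Definition is_codim (K : fieldType) (n : nat)
    (X : set (pspace K n)) (a : nat) : Prop :=
  exists2 r : nat, is_dim X r & a = (n - r)%N.

(* h = dim_K (S / I(X))_m = dim S_m - dim I(X)_m, where S_m is the space of
   forms of degree m and V = I(X)_m the subspace of those vanishing on X. *)
Definition is_hilbert_value (K : fieldType) (n : nat)
    (X : set (pspace K n)) (m h : nat) : Prop :=
  exists2 V : {vspace dhomog n.+1 K m},
    (forall f : dhomog n.+1 K m,
       f \in V <-> forall p, X p -> vanishes_at (val f) p) &
    h = (\dim {: dhomog n.+1 K m} - \dim V)%N.

Definition is_hilbert_poly (K : fieldType) (n : nat)
    (X : set (pspace K n)) (P : {poly rat}) : Prop :=
  exists m0 : nat, forall m, (m0 <= m)%N ->
    exists2 h : nat, is_hilbert_value X m h & P.[m%:R] = h%:R.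

(* deg X is (dim X)! times the leading coefficient of the Hilbert polynomial. *)
Definition is_degree (K : fieldType) (n : nat)
    (X : set (pspace K n)) (e : nat) : Prop :=
  exists (r : nat) (P : {poly rat}),
    [/\ is_dim X r, is_hilbert_poly X P & e%:R = (r`!)%:R * lead_coef P].

Definition slice_decomposition (K : fieldType) (n : nat)
    (F : {mpoly K[n.+1]}) (r : nat) : Prop :=
  exists L H : 'I_r -> {mpoly K[n.+1]},
    [/\ forall i, L i \is 1.-homog,
        forall i, homogeneous (H i) &
        F = \sum_(i < r) L i * H i].

(* A minimum over the empty set is read as +oo: is_slice_rank F holds of no r
   when F has no slice decomposition; likewise for is_strength. *)
Definition is_slice_rank (K : fieldType) (n : nat)
    (F : {mpoly K[n.+1]}) (r : nat) : Prop :=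
  is_minimum (slice_decomposition F) r.

Definition strength_decomposition (K : fieldType) (n : nat) (d k : nat)
    (F : {mpoly K[n.+1]}) (r : nat) : Prop :=
  exists G H : 'I_r -> {mpoly K[n.+1]},
    [/\ forall i, G i \is k.-homog,
        forall i, (exists2 e : nat, (e < d)%N & H i \is e.-homog) &
        F = \sum_(i < r) G i * H i].

(* str_k of a form F of degree d, meant for 1 <= k < d. *)
Definition is_strength (K : fieldType) (n : nat) (d k : nat)
    (F : {mpoly K[n.+1]}) (r : nat) : Prop :=
  is_minimum (strength_decomposition d k F) r.

(* Main.v *)
From HB Require Import structures.
Require Import Defs.
From mathcomp Require Import all_boot all_order all_algebra.
From mathcomp Require Import complex mpoly polyrcf.
From mathcomp Require Import boolp classical_sets reals.
From mathcomp Require Import zify ring lra.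

(** If F is a combination of forms G_1, ..., G_r of degree k, then Z(F) contains
    Z(G_1, ..., G_r), so it suffices to find there an irreducible X with
    codim X <= r and deg X <= k^r.  X is obtained by cutting P^n successively:
    for a homogeneous prime I and a form f of degree k outside I, the exact
    sequence 0 -> S/I(-k) -> S/I -> S/(I+f) -> 0 shows that the Hilbert
    polynomial of I+f has degree one less and a leading term k times as large
    (after normalization).  By the same sequence, an ideal that is maximal among
    those over I+f whose Hilbert polynomial keeps at least this degree is prime,
    and its Hilbert polynomial is bounded by that of I+f.  Strict inclusions of
    primes lower the degree of the Hilbert polynomial and cutting by a linear form
    lowers it by exactly one, so this degree is the dimension defined by chains.
    Primes are turned into varieties by a Nullstellensatz over uncountable
    algebraically closed fields.  When r > n, a point of Z(F) is enough. *)

Set Implicit Arguments.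
Unset Strict Implicit.
Unset Printing Implicit Defensive.

Import Order.TTheory GRing.Theory Num.Theory.
Local Open Scope ring_scope.
Local Open Scope classical_set_scope.

(** * Rational polynomials with integer values: differences and leading terms *)

Section NumericalPolynomials.

Implicit Types P Q : {poly rat}.

Lemma size_shift P (c : rat) : size (P \Po ('X + c%:P)) = size P.
Proof. by rewrite size_comp_poly2 // size_XaddC. Qed.

(** On the term of degree [D], the difference operator of step [c] acts to top order as [c] times
    the derivative. [P] may have smaller degree, and for [D = 0] both sides are zero. *)
Lemma difference_coef D P (c : rat) : (size P <= D.+1)%N ->
  (size (P \Po ('X + c%:P) - P)%R <= D)%N /\
  (P \Po ('X + c%:P) - P)`_D.-1 = c * D%:R * P`_D.
Proof.
elim: D P => [|D IH] P sP.
  by rewrite (size1_polyC sP) comp_polyC subrr size_poly0 coef0 mulr0 mul0r.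
elim/poly_ind: P sP => [|P a _] sP.
  by rewrite comp_poly0 subrr size_poly0 !coef0 mulr0.
have sQ : (size P <= D.+1)%N.
  have [->|P0] := eqVneq P 0; first by rewrite size_poly0.
  move: sP; rewrite size_MXaddC (negbTE P0) /=; lia.
have [sd cd] := IH P sQ.
have -> : (P * 'X + a%:P) \Po ('X + c%:P) - (P * 'X + a%:P) =
   (P \Po ('X + c%:P) - P) * ('X + c%:P) + c%:P * P.
  by rewrite comp_poly_MXaddC; ring.
split.
  apply: leq_trans (size_polyD _ _) _; rewrite geq_max; apply/andP; split.
    by apply: leq_trans (size_polyMleq _ _) _; rewrite size_XaddC; lia.
  by rewrite mul_polyC; apply: leq_trans (size_scale_leq _ _) _.
rewrite [_.-1]/= coefD coefCM mulrDr coefD coefMX coefMC.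
rewrite [(_ * 'X + _)`__]coefD coefMX coefC /=.
rewrite [X in _ + X * c + _]nth_default // mul0r addr0.
case: D sQ sd cd {IH sP} => [|D] /= sQ sd cd; first by rewrite addr0 add0r mulr1.
by rewrite cd addr0 [in RHS]mulrSr; ring.
Qed.

Lemma antidifference Q : exists P, P \Po ('X + 1%:P) - P = Q.
Proof.
have [d] := ubnP (size Q); elim: d Q => // d IH Q; rewrite ltnS => sQ.
case: d => [|d] in IH sQ *.
  move: sQ; rewrite leqn0 size_poly_eq0 => /eqP ->.
  by exists 0; rewrite comp_poly0 subrr.
(* Chosen so that the difference of [P1] has the same coefficient of degree [d] as [Q]; the
   remainder is shorter and falls to induction. *)
pose P1 : {poly rat} := (Q`_d / d.+1%:R) *: 'X^(d.+1).
have sP1 : (size P1 <= d.+2)%N.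
  by apply: leq_trans (size_scale_leq _ _) _; rewrite size_polyXn.
have [s1 c1] := difference_coef 1 sP1.
have cP1 : P1`_d.+1 = Q`_d / d.+1%:R by rewrite coefZ coefXn eqxx mulr1.
have [P2 eP2] : exists P2, P2 \Po ('X + 1%:P) - P2
    = Q - (P1 \Po ('X + 1%:P) - P1).
  apply: IH; rewrite ltnS; apply/leq_sizeP => j; rewrite leq_eqVlt => /predU1P[<-|lt].
    rewrite coefB; rewrite /= in c1; rewrite c1 cP1 mul1r mulrC divfK ?subrr //.
    by rewrite pnatr_eq0.
  by rewrite coefB (leq_sizeP _ _ sQ) // (leq_sizeP _ _ s1) // subrr.
exists (P1 + P2); rewrite comp_polyD -[Q](subrK (P1 \Po ('X + 1%:P) - P1)) -eP2.
by ring.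
Qed.

Lemma eventually_ge0_lead P m0 :
  (forall m, (m0 <= m)%N -> 0 <= P.[m%:R]) -> 0 <= lead_coef P.
Proof.
move=> H; rewrite leNgt; apply/negP => lt0.
have [x Hx] : exists x, forall y, y >= x -> (- P).[y] >= lead_coef (- P).
  by apply: poly_pinfty_gt_lc; rewrite lead_coefN oppr_gt0.
pose m := maxn m0 (Num.truncn `|x|).+1.
have xm : x <= m%:R.
  apply: le_trans (ler_norm x) _; apply: le_trans (ltW (truncnS_gt _)) _.
  by rewrite ler_nat leq_maxr.
have := Hx _ xm; have := H m (leq_maxl _ _); rewrite hornerN lead_coefN; lra.
Qed.

Lemma eventually_eq_poly P Q m0 :
  (forall m, (m0 <= m)%N -> P.[m%:R] = Q.[m%:R]) -> P = Q.
Proof.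
move=> H; apply/eqP; rewrite -subr_eq0; apply/negPn/negP => nz.
have /= := max_poly_roots (rs := [seq (m0 + i)%:R | i <- iota 0 (size (P - Q))]) nz.
rewrite size_map size_iota ltnn => roots_lt; suff: false by []; apply: roots_lt.
- apply/allP => _ /mapP[i _ ->]; rewrite /root hornerD hornerN H ?subrr //.
  exact: leq_addr.
- rewrite map_inj_in_uniq ?iota_uniq // => i j _ _ /eqP.
  by rewrite eqr_nat eqn_add2l => /eqP.
Qed.

(** Eventual signs pass to leading coefficients, applied to [P] and to [Q - P]; a longer [P] would
    make the leading coefficient of [Q - P] negative. *)
Lemma eventually_le_poly P Q m0 :
  (forall m, (m0 <= m)%N -> 0 <= P.[m%:R] <= Q.[m%:R]) ->
  (size P <= size Q)%N /\ (size P = size Q -> lead_coef P <= lead_coef Q).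
Proof.
move=> H.
have lP : 0 <= lead_coef P.
  by apply: (eventually_ge0_lead (m0 := m0)) => m /H /andP[].
have lQP : 0 <= lead_coef (Q - P).
  apply: (eventually_ge0_lead (m0 := m0)) => m /H /andP[_ ?].
  by rewrite hornerD hornerN subr_ge0.
split=> [|eqs].
  rewrite leqNgt; apply/negP => lt.
  move: lQP; rewrite lead_coefDr ?size_polyN // lead_coefN oppr_ge0 => lP'.
  have /eqP : lead_coef P = 0 by apply/le_anti/andP.
  by rewrite lead_coef_eq0 => /eqP P0; rewrite P0 size_poly0 in lt.
rewrite -subr_ge0 /lead_coef eqs -coefB.
have [lt|ge] := ltnP (size (Q - P)) (size Q).
  by rewrite nth_default //; case: (size Q) lt.
suff <- : size (Q - P) = size Q by [].
apply/eqP; rewrite eqn_leq ge andbT.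
by apply: leq_trans (size_polyD _ _) _; rewrite size_polyN eqs maxnn.
Qed.

(** The [D]-th iterated difference of [P] is the constant [D!] times its leading coefficient, and
    differences preserve eventual integrality. *)
Lemma lead_coef_eventually_int D P m0 : size P = D.+1 ->
  (forall m, (m0 <= m)%N -> P.[m%:R] \is a Num.int) ->
  (D`!)%:R * lead_coef P \is a Num.int.
Proof.
elim: D P => [|D IH] P sP H.
  have /size_poly1P[c _ eP] : size P == 1%N by rewrite sP.
  by have := H m0 (leqnn _); rewrite mul1r eP hornerC lead_coefC.
pose Q := P \Po ('X + 1%:P) - P.
have [|sQ cQ] := @difference_coef D.+1 P 1; first by rewrite sP.
rewrite -/Q mul1r /= in sQ cQ.
have lP : P`_D.+1 != 0.
  by rewrite -[D.+1]/(D.+2.-1) -sP -/(lead_coef P) lead_coef_eq0 -size_poly_eq0 sP.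
have sQ' : size Q = D.+1.
  apply/eqP; rewrite eqn_leq sQ ltnNge; apply/negP => /leq_sizeP/(_ D (leqnn _)).
  by rewrite cQ => /eqP; rewrite mulf_eq0 (negbTE lP) orbF pnatr_eq0.
have : D`!%:R * lead_coef Q \is a Num.int.
  apply: IH => // m lem; rewrite /Q hornerD hornerN horner_comp hornerD hornerX hornerC.
  by rewrite natr1 rpredB // H // leqW.
by rewrite /lead_coef sQ' sP /= cQ mulrA -natrM mulnC -factS.
Qed.

End NumericalPolynomials.

(** Among the subspaces contained in [A], one of maximal dimension is all of [A]: a vector of [A]
    outside it would span a larger one. *)
Lemma vspace_of_closed (K : fieldType) (vT : vectType K) (A : vT -> Prop) :
  A 0 -> (forall c u v, A u -> A v -> A (c *: u + v)) ->
  exists V : {vspace vT}, forall u, u \in V <-> A u.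
Proof.
move=> A0 Alin.
pose B d := `[< exists2 V : {vspace vT}, \dim V = d & forall u, u \in V -> A u >].
have exB : exists d, B d.
  exists 0%N; apply/asboolP; exists 0%VS; first exact: dimv0.
  by move=> u; rewrite memv0 => /eqP ->.
have ubB d : B d -> (d <= \dim {:vT})%N.
  by move=> /asboolP[V <- _]; exact/dimvS/subvf.
case: (ex_maxnP exB ubB) => d /asboolP[V dV VA] maxd; exists V => u; split=> [/VA//|Au].
apply/negPn/negP => nVu.
have : (d.+1 <= d)%N.
  apply: maxd; apply/asboolP; exists (V + <[u]>)%VS; last first.
    move=> w /memv_addP[x Vx [y /vlineP[c ->] ->]]; rewrite addrC.
    by apply: Alin => //; apply: VA.
  rewrite dimv_disjoint_sum ?dV ?dim_vline; last first.
    apply/eqP; rewrite -subv0; apply/subvP => w /memv_capP[Vw /vlineP[c ec]].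
    rewrite memv0 ec; have [->|c0] := eqVneq c 0; first by rewrite scale0r.
    by case/negP: nVu; rewrite -[u](scalerK c0) -ec memvZ.
  by case: eqP nVu => [->|_ _]; rewrite ?mem0v // addn1.
by rewrite ltnn.
Qed.

Lemma meval_homog_scale (K : comNzRingType) (n e : nat) (f : {mpoly K[n]})
    (c : K) (v w : 'I_n -> K) :
  f \is e.-homog -> (forall i, w i = c * v i) -> f.@[w] = c ^+ e * f.@[v].
Proof.
move=> /dhomogP hf hw; rewrite !mevalE big_distrr /= !big_seq.
apply: eq_bigr => m /hf /= <-; rewrite mulrCA; congr (_ * _).
rewrite mdegE -prodrXr -big_split /=; apply: eq_bigr => i _.
by rewrite hw exprMn.
Qed.

(* [I e f] reads "f lies in the degree-e piece of the homogeneous ideal I". *)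
Structure gideal (K : fieldType) (n : nat) := GIdeal {
  gmem :> nat -> {mpoly K[n.+1]} -> Prop;
  gmem_homog : forall e f, gmem e f -> f \is e.-homog;
  gmem0 : forall e, gmem e 0;
  gmemP : forall e c f g, gmem e f -> gmem e g -> gmem e (c *: f + g);
  gmemMl : forall e e' f g,
    g \is e'.-homog -> gmem e f -> gmem (e' + e)%N (g * f) }.

(** * Homogeneous ideals, their Hilbert functions, colons and sums *)

Section GradedIdeals.

Variables (K : fieldType) (n : nat).
Local Notation S := {mpoly K[n.+1]}.
Implicit Types (I J : gideal K n) (f g a b : S).

Lemma gmemD I e f g : I e f -> I e g -> I e (f + g).
Proof. by move=> If Ig; rewrite -[f]scale1r; apply: gmemP. Qed.

Lemma gmemZ I e c f : I e f -> I e (c *: f).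
Proof. by move=> If; rewrite -[c *: f]addr0; apply: gmemP => //; apply: gmem0. Qed.

Lemma gmemN I e f : I e f -> I e (- f).
Proof. by move=> If; rewrite -scaleN1r; apply: gmemZ. Qed.

Lemma gmemB I e f g : I e f -> I e g -> I e (f - g).
Proof. by move=> If Ig; apply/gmemD => //; apply: gmemN. Qed.

Lemma gmem_sum I e (T : Type) (r : seq T) (P : pred T) (F : T -> S) :
  (forall i, P i -> I e (F i)) -> I e (\sum_(i <- r | P i) F i).
Proof. by move=> H; elim/big_ind: _ => //; [exact: gmem0 | exact: gmemD]. Qed.

Lemma gmemMr I e e' f g : g \is e'.-homog -> I e f -> I (e + e')%N (f * g).
Proof. by move=> hg If; rewrite addnC mulrC; apply: gmemMl. Qed.

Definition gsub I J := forall e f, I e f -> J e f.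
Definition gproper I J := gsub I J /\ exists e f, J e f /\ ~ I e f.

Definition gpiece_sig I e :
  {V : {vspace dhomog n.+1 K e} | forall f : dhomog n.+1 K e, f \in V <-> I e (val f)}.
Proof.
apply: cid; apply: (vspace_of_closed (A := fun f : dhomog n.+1 K e => I e (val f))).
  exact: gmem0.
by move=> c u v Iu Iv; apply: gmemP.
Qed.

Definition gpiece I e : {vspace dhomog n.+1 K e} := sval (gpiece_sig I e).

Lemma mem_gpiece I e (f : dhomog n.+1 K e) : f \in gpiece I e <-> I e (val f).
Proof. exact: (svalP (gpiece_sig I e)). Qed.

Definition hilb I e : nat := (\dim {: dhomog n.+1 K e} - \dim (gpiece I e))%N.

Lemma hilbE I e : (hilb I e + \dim (gpiece I e))%N = \dim {: dhomog n.+1 K e}.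
Proof. by rewrite /hilb subnK //; apply/dimvS/subvf. Qed.

Lemma hilb_le I J e : gsub I J -> (hilb J e <= hilb I e)%N.
Proof.
move=> IJ; apply/leq_sub2l/dimvS/subvP => f /mem_gpiece If.
by apply/mem_gpiece/IJ.
Qed.

Lemma hilb_eq0 I e : (forall f, f \is e.-homog -> I e f) -> hilb I e = 0%N.
Proof.
move=> H; apply/eqP; rewrite subn_eq0; apply/dimvS/subvP => f _.
by apply/mem_gpiece/H; apply: dhomog_is_dhomog.
Qed.

Section Colon.
Variables (I : gideal K n) (k : nat) (a : S) (ha : a \is k.-homog).

Definition gcolon : gideal K n.
Proof.
refine (@GIdeal K n (fun e f => f \is e.-homog /\ I (k + e)%N (a * f)) _ _ _ _).
- by move=> e f [].
- by move=> e; split; [exact: dhomog0 | rewrite mulr0; apply: gmem0].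
- move=> e c f g [hf If] [hg Ig]; split.
    by apply: dhomogD => //; apply: dhomogZ.
  by rewrite mulrDr -scalerAr; apply: gmemP.
- move=> e e' f g hg [hf If]; split; first exact: dhomogM.
  by rewrite mulrCA addnCA; apply: gmemMl.
Defined.

Lemma gsub_colon : gsub I gcolon.
Proof. by move=> e f If; split; [exact: gmem_homog If | apply: gmemMl]. Qed.

(* The clause on [s] says that [a * s] has degree [e], guarding truncated
   subtraction. *)
Definition gadd_mem (e : nat) (f : S) : Prop :=
  exists q s : S, [/\ I e q, (if (k <= e)%N then s \is (e - k).-homog else s == 0)
    & f = q + a * s].

Definition gadd : gideal K n.
Proof.
refine (@GIdeal K n gadd_mem _ _ _ _).
- move=> e f [q [s [Iq hs ->]]]; apply: dhomogD; first exact: gmem_homog Iq.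
  case: leqP hs => [le hs|_ /eqP ->]; last by rewrite mulr0 dhomog0.
  by rewrite -(subnKC le); apply: dhomogM.
- move=> e; exists 0, 0; split; [exact: gmem0| |by rewrite mulr0 addr0].
  by case: ifP; rewrite ?dhomog0 ?eqxx.
- move=> e c f g [q [s [Iq hs ->]]] [q' [s' [Iq' hs' ->]]].
  exists (c *: q + q'), (c *: s + s'); split; first exact: gmemP.
    case: leqP hs hs' => [le hs hs'|_ /eqP -> /eqP ->].
      by apply: dhomogD => //; apply: dhomogZ.
    by rewrite scaler0 addr0.
  by rewrite scalerDr mulrDr -scalerAr addrACA.
- move=> e e' f g hg [q [s [Iq hs ->]]]; exists (g * q), (g * s); split.
  + exact: gmemMl.
  + case: (leqP k e) hs => [le hs|_ /eqP ->].
      by rewrite (leq_trans le (leq_addl _ _)) -addnBA //; apply: dhomogM.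
    by rewrite mulr0; case: ifP; rewrite ?dhomog0 ?eqxx.
  + by rewrite mulrDr mulrCA.
Defined.

Lemma gsub_add : gsub I gadd.
Proof.
move=> e f If; exists f, 0; split => //; last by rewrite mulr0 addr0.
by case: ifP; rewrite ?dhomog0 ?eqxx.
Qed.

Lemma gadd_gen : gadd k a.
Proof.
exists 0, 1; split; [exact: gmem0 | | by rewrite mulr1 add0r].
by rewrite leqnn subnn dhomog1.
Qed.

Lemma gadd_sub J : gsub I J -> J k a -> gsub gadd J.
Proof.
move=> IJ Ja e f [q [s [/IJ Iq hs ->]]]; apply: gmemD => //.
case: leqP hs => [le hs|_ /eqP ->]; last by rewrite mulr0; apply: gmem0.
by rewrite -(subnKC le); apply: gmemMr.
Qed.

Definition dhomog_mulr e (f : dhomog n.+1 K e) : dhomog n.+1 K (k + e) :=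
  DHomog (dhomogM ha (dhomog_is_dhomog f)).

Lemma dhomog_mulr_is_linear e : linear (@dhomog_mulr e).
Proof. by move=> c u v; apply/val_inj; rewrite /= mulrDr -scalerAr. Qed.

HB.instance Definition _ e :=
  GRing.isLinear.Build K (dhomog n.+1 K e) (dhomog n.+1 K (k + e)) _
    (@dhomog_mulr e) (@dhomog_mulr_is_linear e).

(* 0 -> (S/(I:a))(-k) -> S/I -> S/(I+a) -> 0 *)
Lemma hilb_exact e : a != 0 ->
  hilb I (k + e) = (hilb gcolon e + hilb gadd (k + e))%N.
Proof.
move=> a0; pose phi := linfun (@dhomog_mulr e); set V := gpiece I (k + e).
have ker0 : lker phi == 0%VS.
  apply/lker0P => u v; rewrite !lfunE => /(congr1 val) /= /(mulfI a0) /val_inj.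
  by [].
have eC : gpiece gcolon e = (phi @^-1: V)%VS.
  apply/vspaceP => u; apply/idP/idP; rewrite -memv_preim lfunE.
    by move=> /mem_gpiece[_ ?]; apply/mem_gpiece.
  by move=> /mem_gpiece ?; apply/mem_gpiece; split => //; apply: dhomog_is_dhomog.
have eA : gpiece gadd (k + e) = (V + limg phi)%VS.
  apply/vspaceP => u; apply/idP/idP.
    move=> /mem_gpiece[q [s [Iq]]]; rewrite leq_addr addKn => hs eu.
    apply/memv_addP; exists (DHomog (gmem_homog Iq)); first exact/mem_gpiece.
    exists (phi (DHomog hs)); first by apply: memv_img; apply: memvf.
    by apply/val_inj; rewrite /= lfunE eu.
  move=> /memv_addP[q /mem_gpiece Iq [_ /memv_imgP[s _ ->] ->]].
  apply/mem_gpiece; exists (val q), (val s); split => //; last by rewrite lfunE.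
  by rewrite leq_addr addKn; apply: dhomog_is_dhomog.
(* Multiplication by [a] is injective, so the preimage of [V] has the dimension of [V] met with the
   image; the dimension formula for a sum finishes. *)
have dC : \dim (gpiece gcolon e) = \dim (V :&: limg phi)%VS.
  rewrite -(limg_dim_eq (f := phi)); last by rewrite (eqP ker0) capv0.
  by rewrite eC -lpreim_cap_limg lpreimK // capvSr.
have dS : \dim (limg phi) = \dim {:dhomog n.+1 K e}.
  by apply: limg_dim_eq; rewrite (eqP ker0) capv0.
have := dimv_sum_cap V (limg phi); rewrite -dC -eA dS.
have := hilbE gcolon e; have := hilbE gadd (k + e); have := hilbE I (k + e).
rewrite -/V; lia.
Qed.

End Colon.

(** The first clause excludes the unit ideal and the irrelevant ideal, which have no zeros in
    projective space. Primality is tested on homogeneous elements only. *)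
Definition gprime I : Prop :=
  (exists i, ~ I 1%N 'X_i) /\
  forall e e' f g, f \is e.-homog -> g \is e'.-homog ->
    I (e + e')%N (f * g) -> I e f \/ I e' g.

(** Every monomial of positive degree is divisible by some variable. *)
Lemma irrelevant_full I : (forall i, I 1%N 'X_i) ->
  forall e f, f \is e.+1.-homog -> I e.+1 f.
Proof.
move=> H e f hf; rewrite [f]mpolyE big_seq.
apply: gmem_sum => m mf; apply: gmemZ.
have dm : mdeg m = e.+1 by move/dhomogP: hf; apply.
have [i mi] : exists i, m i != 0%N.
  case: (pickP (fun i => m i != 0%N)) => [i mi|h]; first by exists i.
  by move: dm; rewrite mdegE big1 // => i _; exact/eqP/negPn/negbT/h.
have em : m = (m - U_(i) + U_(i))%MM.
  rewrite submK //; apply/mnm_lepP => j; rewrite mnm1E.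
  by case: eqP => [<-|]//; rewrite lt0n.
have dm' : mdeg (m - U_(i))%MM = e by move: dm; rewrite {1}em mdegD mdeg1 addn1 => -[].
rewrite em mpolyXD -addn1; apply: gmemMl => //.
by rewrite dhomogX /= dm'.
Qed.

End GradedIdeals.

(** * Dickson's lemma and Noetherian induction on homogeneous ideals *)

Lemma nondecreasing_subseq (u : nat -> nat) :
  exists phi : nat -> nat, {homo phi : i j / (i < j)%N} /\
    {homo (u \o phi) : i j / (i <= j)%N}.
Proof.
(* [A m] is a position where [u] attains its minimum over the indices from [m] on; the subsequence
   repeatedly restarts just after the previous such position. *)
have /choice[A HA] : forall m, exists p,
    (m <= p)%N /\ forall q, (m <= q)%N -> (u p <= u q)%N.
  move=> m; have exv : exists v, `[< exists2 p, (m <= p)%N & u p = v >].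
    by exists (u m); apply/asboolP; exists m.
  case: (ex_minnP exv) => v /asboolP[p mp <-] minv; exists p; split=> // q mq.
  by apply: minv; apply/asboolP; exists q.
pose b := fix b i := if i is j.+1 then (A (b j)).+1 else 0%N.
have bS i : (b i < b i.+1)%N by rewrite /= ltnS; case: (HA (b i)).
have bmono : {homo b : i j / (i < j)%N} by apply: homo_ltn => //; apply: ltn_trans.
exists (A \o b); split=> i j ij /=.
  have [h _] := HA (b j); apply: leq_trans h.
  apply: leq_trans (_ : b i.+1 <= _)%N => //.
  by move: ij; rewrite leq_eqVlt => /predU1P[->//|/bmono/ltnW].
have [_ h] := HA (b i); apply: h; apply: leq_trans (proj1 (HA (b j))).
by move: ij; rewrite leq_eqVlt => /predU1P[->//|/bmono/ltnW].
Qed.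

(** Subsequences are extracted one coordinate at a time until every exponent is nondecreasing; the
    first two terms of the result then compare. *)
Lemma dickson (n : nat) (u : nat -> 'X_{1..n}) :
  exists i j, (i < j)%N /\ (u i <= u j)%MM.
Proof.
suff [phi [mono H]] : exists phi : nat -> nat, {homo phi : i j / (i < j)%N} /\
    forall k, k \in enum 'I_n -> {homo (fun i => u (phi i) k) : i j / (i <= j)%N}.
  exists (phi 0%N), (phi 1%N); split; first exact: mono.
  by apply/mnm_lepP => k; apply: (H k) => //; rewrite mem_enum.
elim: (enum 'I_n) => [|k s [phi [mono H]]]; first by exists id; split.
have [psi [mono' H']] := nondecreasing_subseq (fun i => u (phi i) k).
exists (phi \o psi); split=> [i j ij|k']; first exact/mono/mono'.
rewrite inE => /predU1P[->|/H Hk'] i j ij /=; first exact: H'.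
apply: Hk'; move: ij; rewrite leq_eqVlt => /predU1P[->//|/mono'/ltnW//].
Qed.

Lemma mdeg_mlead (K : fieldType) (n e : nat) (f : {mpoly K[n]}) :
  f \is e.-homog -> f != 0 -> mdeg (mlead f) = e.
Proof. by move=> /dhomogP hf f0; apply: hf; apply: mlead_supp. Qed.

Section Noetherian.

Variables (K : fieldType) (n : nat).
Local Notation S := {mpoly K[n.+1]}.
Implicit Types (I J : gideal K n) (f g : S).

(** Division by leading terms: subtracting a multiple of [g] cancels the leading term of [f] without
    leaving [J], and the monomial order is well founded. *)
Lemma gsub_mlead I J : gsub I J ->
  (forall e f, J e f -> f != 0 ->
     exists g, [/\ I e g, g != 0 & mlead g = mlead f]) ->
  gsub J I.
Proof.
move=> IJ H e f; move: {2}(mlead f) (erefl (mlead f)) => m.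
elim/(well_founded_ind (@ltom_wf n.+1)): m f => m IH f em Jf.
have [->|f0] := eqVneq f 0; first exact: gmem0.
have [g [Ig g0 eg]] := H e f Jf f0.
pose c := mleadc f / mleadc g; pose f' := f - c *: g.
have gc0 : mleadc g != 0 by rewrite mleadc_eq0.
have c0 : c != 0 by rewrite mulf_neq0 ?invr_eq0 // mleadc_eq0.
have ef : f = f' + c *: g by rewrite subrK.
rewrite ef; apply: gmemD; last exact: gmemZ.
have [->|f'0] := eqVneq f' 0; first exact: gmem0.
apply: (IH (mlead f')) => //; last by apply: gmemB => //; apply/gmemZ/IJ.
rewrite -em lt_neqAle; apply/andP; split.
  apply: contraNneq f'0 => ef'; rewrite -mleadc_eq0 ef' mcoeffB mcoeffZ.
  by rewrite /c eg divfK ?subrr // -eg.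
by have := mleadB_le f (c *: g); rewrite mleadZ // eg joinxx.
Qed.

(** A counterexample yields a strictly increasing chain. By [gsub_mlead] each step contains a form
    whose leading monomial is new in its degree; by Dickson an earlier one divides a later one, and
    a monomial multiple of the earlier form contradicts the novelty of the later. *)
Lemma gideal_ind (P : gideal K n -> Prop) :
  (forall I, (forall J, gproper I J -> P J) -> P I) -> forall I, P I.
Proof.
move=> IH I0; apply: contrapT => nP0.
have /choice[step Hstep] :
    forall I, exists J, ~ P I -> gproper I J /\ ~ P J.
  move=> I; have [PI|nPI] := pselect (P I); first by exists I.
  apply: contrapT => nJ; apply: nPI; apply: IH => J IJ.
  by apply: contrapT => nPJ; apply: nJ; exists J.
pose W i := iter i step I0.
have nPW i : ~ P (W i) by elim: i => //= i /Hstep[].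
have Wsub i j : (i <= j)%N -> gsub (W i) (W j).
  move=> /subnK <-; elim: (j - i)%N => [//|d IHd] e f /IHd.
  by rewrite addSn /=; have [[h _] _] := Hstep _ (nPW (d + i)%N); apply: h.
have /choice[F HF] : forall i, exists f : S, f != 0 /\ exists e, W i.+1 e f /\
    forall g, W i e g -> g != 0 -> mlead g <> mlead f.
  move=> i; apply: contrapT => nf.
  have [[sub [e [f [Jf nIf]]]] _] := Hstep _ (nPW i).
  apply: nIf; apply: (gsub_mlead sub) Jf => {}e {}f Jf f0.
  apply: contrapT => ng; apply: nf; exists f; split => //; exists e.
  split => // g Ig g0 eg.
  by apply: ng; exists g.
have [i [j [ij le]]] := dickson (fun i => mlead (F i)).
have [Fi0 [ei [WFi _]]] := HF i; have [Fj0 [ej [WFj H]]] := HF j.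
pose m := (mlead (F j) - mlead (F i))%MM.
have ej_eq : ej = (mdeg m + ei)%N.
  rewrite -(mdeg_mlead (gmem_homog WFj)) // -(mdeg_mlead (gmem_homog WFi)) //.
  by rewrite -mdegD submK.
apply: (H ('X_[m] * F i)).
- rewrite ej_eq; apply: gmemMl; first by rewrite dhomogX.
  exact: Wsub WFi.
- by rewrite mulf_neq0 // -msize_poly_eq0 msizeX.
- by rewrite mleadM ?mleadXm ?submK // -msize_poly_eq0 msizeX.
Qed.

End Noetherian.

(** * Hilbert polynomials, and cutting a prime by a form *)

Section HilbertPolynomials.

Variables (K : fieldType) (n : nat).
Local Notation S := {mpoly K[n.+1]}.
Implicit Types (I J : gideal K n) (f g : S) (P Q : {poly rat}).

Definition hilb_poly I P : Prop :=
  exists m0, forall m, (m0 <= m)%N -> P.[m%:R] = (hilb I m)%:R.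

Lemma horner_shift_sub P (k m : nat) :
  (P \Po ('X + (- k%:R)%:P)).[(k + m)%:R] = P.[m%:R].
Proof. by rewrite horner_comp hornerD hornerX hornerC natrD addrAC subrr add0r. Qed.

Lemma hilb_poly_exact I k (a : S) (ha : a \is k.-homog) PC PA : a != 0 ->
  hilb_poly (gcolon I k a) PC -> hilb_poly (gadd I ha) PA ->
  hilb_poly I ((PC \Po ('X + (- k%:R)%:P)) + PA).
Proof.
move=> a0 [m1 H1] [m2 H2]; exists (k + (m1 + m2))%N => m lem.
have km : (k <= m)%N by lia.
rewrite -(subnKC km) hornerD horner_shift_sub (hilb_exact I ha _ a0) [RHS]natrD.
rewrite H1; last by lia.
by rewrite H2; last by lia.
Qed.

Lemma gproper_add I k (a : S) (ha : a \is k.-homog) :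
  ~ I k a -> gproper I (gadd I ha).
Proof.
move=> nIa; split; first exact: gsub_add.
by exists k, a; split => //; apply: gadd_gen.
Qed.

Lemma mpolyX_neq0 i : 'X_i != 0 :> S.
Proof. by rewrite -msize_poly_eq0 msizeX. Qed.

Lemma dhomogXU i : ('X_i : S) \is 1.-homog.
Proof. by rewrite dhomogX /= mdeg1. Qed.

(** Noetherian induction with a variable [x] outside [I]. If [I : x] is larger than [I], the exact
    sequence adds two known polynomials; otherwise it gives the first difference of the Hilbert
    function of [I], which is then summed. *)
Lemma hilb_poly_exists I : exists P, hilb_poly I P.
Proof.
elim/gideal_ind: I => I IH.
have [full|/existsNP[i nIi]] := pselect (forall i, I 1%N 'X_i).
  exists 0, 1%N => -[//|m] _; rewrite hilb_eq0 ?horner0 // => f.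
  exact: irrelevant_full.
have hx := dhomogXU i; have x0 := mpolyX_neq0 i.
have [PA HA] := IH _ (gproper_add hx nIi).
have [CI|nCI] := pselect (gsub (gcolon I 1 'X_i) I); last first.
  have [PC HC] : exists P, hilb_poly (gcolon I 1 'X_i) P.
    apply: IH; split; first exact: gsub_colon.
    apply: contrapT => H; apply: nCI => e f Cf; apply: contrapT => nIf.
    by apply: H; exists e, f.
  by eexists; apply: hilb_poly_exact x0 HC HA.
have eC m : hilb (gcolon I 1 'X_i) m = hilb I m.
  by apply/eqP; rewrite eqn_leq !hilb_le //; apply: gsub_colon.
(* For large [m], the increment of the Hilbert function of [I] from [m] to [m + 1] is the value of
   [PA] at [m + 1], hence the shift. *)
have [P eP] := antidifference (PA \Po ('X + 1%:P)).
have [m0 H0] := HA.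
pose c : rat := (hilb I m0)%:R - P.[m0%:R].
exists (P + c%:P), m0 => m /subnK <-; rewrite addnC.
elim: (m - m0)%N => [|d IHd]; first by rewrite addn0 hornerD hornerC /c addrC subrK.
have eP' := congr1 (fun p => p.[(m0 + d)%:R]) eP.
rewrite /= hornerD hornerN !horner_comp hornerD hornerX hornerC natr1 in eP'.
rewrite H0 in eP'; last by lia.
rewrite addnS; have := hilb_exact I hx (m0 + d)%N x0; rewrite add1n eC => ->.
move: IHd; rewrite !hornerD !hornerC => IHd.
by rewrite [RHS]natrD -IHd -eP'; ring.
Qed.

Lemma hilb_poly_uniq I P Q : hilb_poly I P -> hilb_poly I Q -> P = Q.
Proof.
move=> [m1 H1] [m2 H2]; apply: (eventually_eq_poly (m0 := maxn m1 m2)) => m.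
by rewrite geq_max => /andP[? ?]; rewrite H1 ?H2.
Qed.

Lemma hilb_poly_le I J P Q : gsub I J -> hilb_poly I P -> hilb_poly J Q ->
  (size Q <= size P)%N /\ (size Q = size P -> lead_coef Q <= lead_coef P).
Proof.
move=> IJ [m1 H1] [m2 H2]; apply: (eventually_le_poly (m0 := maxn m1 m2)) => m.
rewrite geq_max => /andP[? ?]; rewrite H1 ?H2 // ler0n ler_nat.
exact: hilb_le.
Qed.

(** If [f * g] lies in [I] but neither factor does, both [I : f] and [I + f] are strictly larger,
    and since [P] is a shift of one polynomial plus the other, one of them still has size at least
    [t]. Positivity of [t] rules out ideals containing all variables, for which [P = 0]. *)
Lemma gprime_above t I P : (0 < t)%N -> hilb_poly I P -> (t <= size P)%N ->
  exists J Q, [/\ gprime J, gsub I J, hilb_poly J Q & (t <= size Q)%N].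
Proof.
move=> t0; elim/gideal_ind: I P => I IH P HP tP.
have [|/not_andP[nrel|nprime]] := pselect (gprime I).
    by move=> prI; exists I, P; split => // d h.
  have full i : I 1%N 'X_i by apply: contrapT => h; apply: nrel; exists i.
  suff P0 : P = 0 by move: tP t0; rewrite P0 size_poly0 leqn0 => /eqP ->.
  apply: (hilb_poly_uniq HP); exists 1%N => -[//|m] _.
  by rewrite hilb_eq0 ?horner0 // => f; apply: irrelevant_full.
have [e [e' [f [g [hf [hg [Ifg [nIf nIg]]]]]]]] :
    exists e e' f g, f \is e.-homog /\ g \is e'.-homog /\ I (e + e')%N (f * g) /\
      ~ I e f /\ ~ I e' g.
  apply: contrapT => H; apply: nprime => e e' f g hf hg Ifg.
  by apply: contrapT => /not_orP[? ?]; apply: H; exists e, e', f, g.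
have f0 : f != 0 by apply/eqP => ef; apply: nIf; rewrite ef; apply: gmem0.
have [PC HC] := hilb_poly_exists (gcolon I e f).
have [PA HA] := hilb_poly_exists (gadd I hf).
have eP := hilb_poly_uniq HP (hilb_poly_exact f0 HC HA).
have : (t <= maxn (size PC) (size PA))%N.
  apply: leq_trans tP _; rewrite eP.
  by apply: leq_trans (size_polyD _ _) _; rewrite size_shift.
rewrite leq_max => /orP[tC|tA].
  have prC : gproper I (gcolon I e f).
    by split; [exact: gsub_colon | exists e', g].
  have [J [Q [? IJ ? ?]]] := IH _ prC _ HC tC.
  by exists J, Q; split => // d h Ih; apply/IJ/(proj1 prC).
have prA := gproper_add hf nIf.
have [J [Q [? IJ ? ?]]] := IH _ prA _ HA tA.
by exists J, Q; split => // d h Ih; apply/IJ/(proj1 prA).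
Qed.

Lemma gprime_notin1 I : gprime I -> ~ I 0%N 1.
Proof.
move=> [[i nIi] _] I1; apply: nIi; rewrite -['X_i]mulr1 -[1%N]addn0.
by apply: gmemMl => //; apply: dhomogXU.
Qed.

Lemma gprime_exp I e f m : gprime I -> f \is e.-homog -> ~ I e f ->
  ~ I (e * m)%N (f ^+ m).
Proof.
move=> prI hf nIf; elim: m => [|m IH]; first by rewrite muln0; apply: gprime_notin1.
rewrite exprS mulnS; have [_ mulI] := prI.
by move=> /(mulI _ _ _ _ hf (dhomogMn m hf))[].
Qed.

Lemma gprime_hilb_gt0 I m : gprime I -> (0 < hilb I m)%N.
Proof.
move=> prI; have [[i nIi] _] := prI.
have hm : 'X_i ^+ m \is [in K[n.+1], m.-homog].
  by rewrite -{2}[m]mul1n; apply/dhomogMn/dhomogXU.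
rewrite subn_gt0 ltnNge; apply/negP => le.
have : DHomog hm \in gpiece I m.
  have := dimv_leqif_sup (subvf (gpiece I m)).
  by case=> le1; rewrite eqn_leq le1 le => /esym/subvP; apply; apply: memvf.
by move/mem_gpiece; have := gprime_exp (m := m) prI (dhomogXU i) nIi; rewrite mul1n.
Qed.

Lemma gprime_poly_neq0 I P : gprime I -> hilb_poly I P -> P != 0.
Proof.
move=> prI [m H]; apply/eqP => P0; have := H m (leqnn _).
move/esym/eqP; rewrite P0 horner0 pnatr_eq0; have := gprime_hilb_gt0 m prI; lia.
Qed.

Lemma gprime_colon I k (f : S) (hf : f \is k.-homog) : gprime I -> ~ I k f ->
  gsub (gcolon I k f) I.
Proof. by move=> [_ prI] nIf e g [hg /(prI _ _ _ _ hf hg)[]]. Qed.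

Lemma gprime_add_poly I k (f : S) (hf : f \is k.-homog) P :
  gprime I -> ~ I k f -> hilb_poly I P ->
  hilb_poly (gadd I hf) (P - (P \Po ('X + (- k%:R)%:P))).
Proof.
move=> prI nIf [m0 H0]; exists (k + m0)%N => m lem.
have f0 : f != 0 by apply/eqP => ef; apply: nIf; rewrite ef; apply: gmem0.
have km : (k <= m)%N by lia.
rewrite -(subnKC km) hornerD hornerN horner_shift_sub H0; last by lia.
rewrite H0; last by lia.
have eC : hilb (gcolon I k f) (m - k) = hilb I (m - k).
  by apply/eqP; rewrite eqn_leq !hilb_le //; [exact: gprime_colon | exact: gsub_colon].
by rewrite (hilb_exact I hf _ f0) eC natrD addrAC subrr add0r.
Qed.

(** For [f] in [J] outside the prime [I], the ideal [J] contains [I + f], whose Hilbert polynomial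
    is a difference of [P] and so is shorter. *)
Lemma gproper_poly I J P Q : gprime I -> gproper I J ->
  hilb_poly I P -> hilb_poly J Q -> (size Q < size P)%N.
Proof.
move=> prI [IJ [k [f [Jf nIf]]]] HP HQ; have hf := gmem_homog Jf.
have P0 : (0 < size P)%N by rewrite size_poly_gt0; apply: gprime_poly_neq0 HP.
have HA := gprime_add_poly hf prI nIf HP.
have [le _] := hilb_poly_le (gadd_sub (ha := hf) IJ Jf) HA HQ.
apply: leq_ltn_trans le _; rewrite -(prednK P0) ltnS -size_polyN opprB.
by have [] := @difference_coef (size P).-1 P (- k%:R); rewrite ?prednK.
Qed.

(** Dimension and degree as read off the Hilbert polynomial; [zset_dim] later matches [D] with the
    dimension by chains. *)
Definition hdata I (D e : nat) : Prop :=
  exists P, [/\ hilb_poly I P, size P = D.+1 & (D`!)%:R * lead_coef P = e%:R].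

Lemma hilb_poly_hdata I D P : hilb_poly I P -> size P = D.+1 ->
  exists e, hdata I D e.
Proof.
move=> HP sP; have [m0 H0] := HP.
have : D`!%:R * lead_coef P \is a Num.nat.
  rewrite natrEint; apply/andP; split.
    by apply: (lead_coef_eventually_int (m0 := m0) sP) => m /H0 ->; apply: intr_nat.
  rewrite mulr_ge0 ?ler0n //; apply: (eventually_ge0_lead (m0 := m0)) => m /H0 ->.
  exact: ler0n.
by move=> /natrP[e He]; exists e, P.
Qed.


(** The polynomial of [I + f] has size exactly [D.+1] and leading coefficient [k * D.+1] times that
    of [P]. A prime above it of the same size can only have a smaller or equal leading coefficient,
    whence the factor [k]. *)
Lemma gprime_cut I D e k (f : S) : gprime I -> hdata I D.+1 e ->
  (0 < k)%N -> f \is k.-homog -> ~ I k f ->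
  exists J e', [/\ gprime J, gsub I J, J k f, hdata J D e' & (e' <= k * e)%N].
Proof.
move=> prI [P [HP sP lP]] k0 hf nIf.
have HA := gprime_add_poly hf prI nIf HP.
set PA := (P - _) in HA.
have [|sD cD] := @difference_coef D.+1 P (- k%:R); first by rewrite sP.
have sA : (size PA <= D.+1)%N by rewrite -size_polyN opprB.
have cA : PA`_D = k%:R * D.+1%:R * lead_coef P.
  by rewrite -[PA]opprB coefN [D]/(D.+1.-1) cD /lead_coef sP !mulNr opprK.
have sA' : size PA = D.+1.
  apply/eqP; rewrite eqn_leq sA ltnNge; apply/negP => /leq_sizeP/(_ D (leqnn _))/eqP.
  rewrite cA !mulf_eq0 !pnatr_eq0 lead_coef_eq0 -size_poly_eq0 sP !orbF.
  by case: k k0 {hf nIf HA PA sD cD sA cA}.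
have [J [Q [prJ AJ HQ sQ]]] := @gprime_above D.+1 _ _ isT HA (eq_leq (esym sA')).
have [leQ lcQ] := hilb_poly_le AJ HA HQ.
have sQ' : size Q = D.+1 by apply/eqP; rewrite eqn_leq sQ -sA' leQ.
have [e' He'] := hilb_poly_hdata HQ sQ'.
have [Q' [HQ' _ lQ']] := He'.
exists J, e'; split => //.
- by move=> d h Ih; apply/AJ/gsub_add.
- exact/AJ/gadd_gen.
rewrite -(ler_nat rat) -lQ' (hilb_poly_uniq HQ' HQ) natrM -lP factS natrM.
have := lcQ (etrans sQ' (esym sA')); rewrite [X in _ <= X]/lead_coef sA' /= cA => le.
apply: le_trans (ler_wpM2l (ler0n _ _) le) _.
by rewrite le_eqVlt; apply/orP; left; apply/eqP; ring.
Qed.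

End HilbertPolynomials.

(* A consequence of uncountability, sufficient for the Nullstellensatz. *)
Definition infinite_fibers (K : eqType) : Prop :=
  forall N : K -> nat, exists m, forall s : seq K,
    exists2 c, c \notin s & (N c <= m)%N.

(** * Binary forms in two forms of equal degree, modulo a prime *)

Section BinaryForms.

Variables (K : closedFieldType) (n k : nat) (M : gideal K n).
Local Notation S := {mpoly K[n.+1]}.
Variables (a g : S).
Implicit Types p q : {poly K}.
Hypotheses (ha : a \is k.-homog) (hg : g \is k.-homog) (prM : gprime M).
Hypotheses (nMg : ~ M k g) (nMa : forall c, ~ M k (a - c *: g)).

(** For [p] of degree at most [d] this is [g^d p(a/g)], the homogenization of [p] evaluated at [a]
    and [g]. *)
Definition bform (d : nat) (p : {poly K}) : S :=
  \sum_(i < d.+1) p`_i *: (a ^+ i * g ^+ (d - i)).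

Lemma bformD d p q : bform d (p + q) = bform d p + bform d q.
Proof. by rewrite -big_split; apply: eq_bigr => i _; rewrite coefD scalerDl. Qed.

Lemma bformZ d c p : bform d (c *: p) = c *: bform d p.
Proof. by rewrite scaler_sumr; apply: eq_bigr => i _; rewrite coefZ scalerA. Qed.

Lemma bform0 d : bform d 0 = 0.
Proof. by rewrite /bform big1 // => i _; rewrite coef0 scale0r. Qed.

Lemma bform_sum d (T : Type) (r : seq T) (F : T -> {poly K}) :
  bform d (\sum_(i <- r) F i) = \sum_(i <- r) bform d (F i).
Proof. by apply: (big_morph (bform d) (bformD d) (bform0 d)). Qed.

Lemma bform_homog d p : bform d p \is (k * d).-homog.
Proof.
apply: rpred_sum => i _; apply: rpredZ.
have -> : (k * d = k * i + k * (d - i))%N by rewrite -mulnDr subnKC // -ltnS.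
by apply: dhomogM; apply: dhomogMn.
Qed.

Lemma bform_low d p : (size p <= d.+1)%N -> bform d.+1 p = g * bform d p.
Proof.
move=> sp; rewrite /bform big_ord_recr /= nth_default // scale0r addr0 mulr_sumr.
by apply: eq_bigr => i _; rewrite -scalerAr mulrCA -exprS subSn -1?ltnS.
Qed.

Lemma bformXM d p : bform d.+1 (p * 'X) = a * bform d p.
Proof.
rewrite /bform big_ord_recl coefMX eqxx scale0r add0r mulr_sumr.
by apply: eq_bigr => i _; rewrite coefMX /= -scalerAr mulrA -exprS subSS.
Qed.

Lemma bformXsubCM d z p : (size p <= d.+1)%N ->
  bform d.+1 (p * ('X - z%:P)) = (a - z *: g) * bform d p.
Proof.
move=> sp; rewrite mulrDr -polyCN [p * (- z)%:P]mulrC mul_polyC bformD bformZ.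
by rewrite bformXM bform_low // scaleNr mulrDl mulNr scalerAl.
Qed.

Lemma bform_prod (r : seq K) :
  bform (size r) (\prod_(z <- r) ('X - z%:P)) = \prod_(z <- r) (a - z *: g).
Proof.
elim: r => [|z r IH].
  by rewrite !big_nil /bform big_ord1 coefC eqxx scale1r mulr1.
rewrite !big_cons mulrC /= bformXsubCM ?IH //.
by rewrite size_prod_XsubC.
Qed.

(** Over an algebraically closed field the form splits, up to a nonzero constant, into factors [g]
    and [a - z *: g], none of which lies in the prime [M]. *)
Lemma bform_notin d p : p != 0 -> (size p <= d.+1)%N -> ~ M (k * d)%N (bform d p).
Proof.
have [_ mulM] := prM.
elim: d p => [|d IH] p p0 sp.
  rewrite muln0 /bform big_ord1 mulr1 => M1; apply: (gprime_notin1 prM).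
  have p00 : p`_0 != 0 by apply: contraNneq p0 => p00; rewrite (size1_polyC sp) p00.
  by rewrite -[1](scalerK p00); apply: gmemZ.
have [lt|ge] := leqP (size p) d.+1.
  by rewrite bform_low // mulnS => /(mulM _ _ _ _ hg (bform_homog d p))[//|]; apply: IH.
have /closed_rootP[z rz] : size p != 1%N by case: (size p) ge => [|[]].
have /factor_theorem[q eq] := rz.
have q0 : q != 0 by apply: contraNneq p0 => q0; rewrite eq q0 mul0r.
have sq : (size q <= d.+1)%N.
  by move: sp; rewrite eq size_Mmonic ?monicXsubC // size_XsubC addn2.
have hz : (a - z *: g) \is k.-homog by apply: rpredB => //; apply: rpredZ.
rewrite eq bformXsubCM // mulnS => /(mulM _ _ _ _ hz (bform_homog d q))[].
  exact: nMa.
exact: IH.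
Qed.

End BinaryForms.

(** * A projective Nullstellensatz *)

Section Nullstellensatz.

Variables (K : closedFieldType) (n : nat).
Local Notation S := {mpoly K[n.+1]}.
Implicit Types (I M : gideal K n) (f g a b : S).
Hypothesis fibK : infinite_fibers K.

(** States that [a] becomes invertible in [(S/M)[1/g]]. *)
Definition divides_power M k g e a : Prop :=
  exists N b e', [/\ b \is e'.-homog, (e + e' = k * N)%N
    & M (k * N)%N (g ^+ N - a * b)].

(** Noetherian induction: enlarge [I] as long as no power of [g] is captured. At the end every form
    outside divides a power of [g] modulo [I]; if [f * f'] were in [I] with both factors outside,
    multiplying the two divisibilities would put a power of [g] in [I]. *)
Lemma max_avoiding I k g : g \is k.-homog -> (0 < k)%N ->
  (forall N, ~ I (k * N)%N (g ^+ N)) ->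
  exists M, [/\ gsub I M, gprime M, forall N, ~ M (k * N)%N (g ^+ N) &
    forall e a, a \is e.-homog -> ~ M e a -> divides_power M k g e a].
Proof.
move=> hg k0; elim/gideal_ind: I => I IH nIg.
have [[e [a [h [nIa nAg]]]]|H] := pselect (exists e a (h : a \is e.-homog),
    ~ I e a /\ forall N, ~ gadd I h (k * N)%N (g ^+ N)).
  have [M [AM prM nMg HM]] := IH _ (gproper_add h nIa) nAg.
  by exists M; split => // d f If; apply/AM/gsub_add.
have div e a : a \is e.-homog -> ~ I e a -> divides_power I k g e a.
  move=> h nIa.
  have [N] : exists N, gadd I h (k * N)%N (g ^+ N).
    by apply: contrapT => /forallNP nA; apply: H; exists e, a, h.
  case=> q [b [Iq]]; case: leqP => [le hb eg|_ /eqP -> eg].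
    by exists N, b, (k * N - e)%N; rewrite subnKC // eg addrK.
  by case: (nIg N); rewrite eg mulr0 addr0.
exists I; split => //; split=> [|e e' f f' hf hf' Iff'].
  apply: contrapT => nrel; apply: (nIg 1%N); rewrite muln1 expr1.
  rewrite -(prednK k0); apply: irrelevant_full; last by rewrite prednK.
  by move=> i; apply: contrapT => ?; apply: nrel; exists i.
apply: contrapT => /not_orP[/(div _ _ hf)[N [b [d [hb ed Ib]]]]].
move=> /(div _ _ hf')[N' [b' [d' [hb' ed' Ib']]]].
apply: (nIg (N + N')%N).
have -> : g ^+ (N + N') = (g ^+ N - f * b) * g ^+ N' +
    (f * b) * (g ^+ N' - f' * b') + (f * f') * (b * b').
  by rewrite exprD; ring.
rewrite mulnDr; apply: gmemD; first apply: gmemD.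
- by apply: gmemMr => //; apply: dhomogMn.
- by apply: gmemMl => //; rewrite -ed; apply: dhomogM.
- by rewrite -ed -ed' addnACA; apply: gmemMr => //; apply: dhomogM.
Qed.

Lemma uniq_fiber (N : K -> nat) : exists m, forall t, exists s : seq K,
  [/\ uniq s, size s = t & forall c, c \in s -> (N c <= m)%N].
Proof.
have [m Hm] := fibK N; exists m; elim=> [|t [s [us ss Hs]]]; first by exists [::].
have [c cs Nc] := Hm s; exists (c :: s); split=> /=; rewrite ?cs ?ss //.
by move=> c'; rewrite inE => /predU1P[->//|/Hs].
Qed.

(* The elements 1/(a/g - c) of the degree-0 part of (S/M)[1/g] are linearly
   independent over K unless a/g is constant; infinitely many of them have a
   common denominator, which contradicts the finiteness of the dimension. *)
Lemma residue_line M k g a : gprime M -> g \is k.-homog -> a \is k.-homog ->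
  (0 < k)%N -> ~ M k g ->
  (forall e b, b \is e.-homog -> ~ M e b -> divides_power M k g e b) ->
  exists c, M k (a - c *: g).
Proof.
move=> prM hg ha k0 nMg div; apply: contrapT => /forallNP nMa.
have hc c : a - c *: g \is k.-homog by apply: rpredB => //; apply: rpredZ.
have /choice[Nb HNb] : forall c, exists Nb : nat * S,
    [/\ (0 < Nb.1)%N, Nb.2 \is (k * Nb.1 - k).-homog
      & M (k * Nb.1)%N (g ^+ Nb.1 - (a - c *: g) * Nb.2)].
  move=> c; have [N [b [e' [hb ee Mb]]]] := div _ _ (hc c) (nMa c).
  exists (N, b); split=> //=; last by rewrite -ee addKn.
  by case: N ee {Mb} => //; rewrite muln0; lia.
have [m Hm] := uniq_fiber (fun c => (Nb c).1).
(* Modulo [M], [B c] represents [g^m / (a - c g)], in a degree that does not depend on [c]. *)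
pose B c := (Nb c).2 * g ^+ (m - (Nb c).1).
have hB c : ((Nb c).1 <= m)%N -> B c \is (k * m - k).-homog.
  move=> le; have [N0 hb _] := HNb c.
  have -> : (k * m - k = (k * (Nb c).1 - k) + k * (m - (Nb c).1))%N.
    by rewrite mulnBr; nia.
  by apply: dhomogM => //; apply: dhomogMn.
have MB c : ((Nb c).1 <= m)%N -> M (k * m)%N (g ^+ m - (a - c *: g) * B c).
  move=> le; have [N0 hb Mb] := HNb c.
  have -> : g ^+ m - (a - c *: g) * B c =
      (g ^+ (Nb c).1 - (a - c *: g) * (Nb c).2) * g ^+ (m - (Nb c).1).
    by rewrite /B -{1}(subnKC le) exprD; ring.
  have -> : (k * m = k * (Nb c).1 + k * (m - (Nb c).1))%N by rewrite -mulnDr subnKC.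
  by apply: gmemMr => //; apply: dhomogMn.
set h := \dim {: dhomog n.+1 K (k * m - k)}.
have [s [us ss Hs]] := Hm h.+1.
pose c (i : 'I_h.+1) := s`_i.
have cN i : ((Nb (c i)).1 <= m)%N by apply/Hs/mem_nth; rewrite ss.
pose X := [tuple DHomog (hB (c i) (cN i)) | i < h.+1].
(* [X] has one element more than the dimension [h] of the space it lives in. *)
suff : free X.
  rewrite /free size_tuple => /eqP eh; have := dimvS (subvf <<X>>%VS).
  by rewrite eh ltnn.
apply/freeP => la rel0 i0.
have rel : \sum_i la i *: B (c i) = 0.
  have eX (i : 'I_h.+1) : val X`_i = B (c i) by rewrite -tnth_nth tnth_mktuple.
  have := congr1 (@mpoly_of_dhomog _ _ _) rel0; rewrite raddf_sum => rel.
  rewrite -[RHS]rel.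
  by apply: eq_bigr => i _; rewrite -eX.
pose r (i : 'I_h.+1) := [seq c j | j <- enum (predC1 i)].
have sr i : size (r i) = h by rewrite size_map -cardE cardC1 card_ord.
have big_r (F : K -> S) i : \prod_(z <- r i) F z = \prod_(j | j != i) F (c j).
  by rewrite big_map big_enum.
(* Clearing the denominators [a - c_i g] in the relation between the fractions leaves the binary
   form of this polynomial, which must therefore lie in [M]. *)
pose p := \sum_i la i *: \prod_(z <- r i) ('X - z%:P).
have sp : (size p <= h.+1)%N.
  apply: leq_trans (size_sum _ _ _) _; apply/bigmax_leqP => i _.
  by apply: leq_trans (size_scale_leq _ _) _; rewrite size_prod_XsubC sr.
have Mp : M (k * h)%N (bform a g h p).
  have ep : bform a g h p = \sum_i la i *: \prod_(z <- r i) (a - z *: g).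
    by rewrite bform_sum; apply: eq_bigr => i _; rewrite bformZ -{1}(sr i) bform_prod.
  have [_ mulM] := prM.
  suff Mgp : M (k * m + k * h)%N (g ^+ m * bform a g h p).
    have [/(gprime_exp prM hg nMg)//|//] :=
      mulM _ _ _ _ (dhomogMn m hg) (bform_homog ha hg h p) Mgp.
  pose Q := \prod_j (a - c j *: g).
  have -> : g ^+ m * bform a g h p = \sum_i la i *:
      ((g ^+ m - (a - c i *: g) * B (c i)) * \prod_(z <- r i) (a - z *: g)).
    have -> : g ^+ m * bform a g h p =
        g ^+ m * bform a g h p - Q * (\sum_i la i *: B (c i)).
      by rewrite rel mulr0 subr0.
    rewrite ep !mulr_sumr -sumrB; apply: eq_bigr => i _.
    rewrite -!scalerAr -scalerBr; congr (_ *: _).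
    have -> : Q = (a - c i *: g) * \prod_(z <- r i) (a - z *: g).
      by rewrite big_r /Q (bigD1 i).
    by ring.
  apply: gmem_sum => i _; apply: gmemZ; apply: gmemMr; last exact: MB.
  have := bform_homog ha hg (size (r i)) (\prod_(z <- r i) ('X - z%:P)).
  by rewrite bform_prod sr.
have p0 : p = 0.
  apply/eqP/negPn/negP => p0; exact: (bform_notin ha hg prM nMg nMa p0 sp Mp).
(* At [c i0] every term but that of [i0] vanishes, and the remaining product is nonzero because the
   [c j] are distinct; so [la i0 = 0]. *)
have : p.[c i0] = 0 by rewrite p0 horner0.
rewrite /p horner_sum (bigD1 i0) //= [X in _ + X]big1 => [|i ii0]; last first.
  rewrite hornerZ big_map big_enum /= horner_prod (bigD1 i0) /=; last first.
    by rewrite inE eq_sym.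
  by rewrite hornerXsubC subrr mul0r mulr0.
rewrite addr0 hornerZ => /eqP; rewrite mulf_eq0 => /orP[/eqP //|].
rewrite big_map big_enum /= horner_prod => /prodf_eq0[j ji0].
rewrite hornerXsubC subr_eq0 nth_uniq ?ss // => /eqP/val_inj e.
by rewrite inE e eqxx in ji0.
Qed.

(** Modulo [M] each variable is a multiple of ['X_j], so substitution turns a form into its value at
    [v] times a power of ['X_j]. *)
Lemma eval_congr M j (v : 'I_n.+1 -> K) :
  (forall i, M 1%N ('X_i - v i *: 'X_j)) ->
  forall e f, f \is e.-homog -> M e (f - f.@[v] *: 'X_j ^+ e).
Proof.
move=> Hv e f hf; have hj m : 'X_j ^+ m \is [in K[n.+1], m.-homog].
  by rewrite -{2}[m]mul1n; apply/dhomogMn/dhomogXU.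
(* The degree is kept existential so that the property is multiplicative and passes to monomials;
   [Mm] recovers the degree. *)
pose C (f : S) := exists2 e, f \is e.-homog & M e (f - f.@[v] *: 'X_j ^+ e).
have C1 : C 1.
  exists 0%N; rewrite ?dhomog1 // meval1 scale1r subrr; exact: gmem0.
have CM f1 f2 : C f1 -> C f2 -> C (f1 * f2).
  move=> [e1 h1 M1] [e2 h2 M2]; exists (e1 + e2)%N; first exact: dhomogM.
  have -> : f1 * f2 - (f1 * f2).@[v] *: 'X_j ^+ (e1 + e2) =
      (f1 - f1.@[v] *: 'X_j ^+ e1) * f2
      + (f1.@[v] *: 'X_j ^+ e1) * (f2 - f2.@[v] *: 'X_j ^+ e2).
    by rewrite mevalM exprD mulrBl mulrBr -scalerA -!scalerAl -!scalerAr; ring.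
  by apply: gmemD; [apply: gmemMr | apply: gmemMl => //; apply: dhomogZ; apply: hj].
have CX m : C 'X_[m].
  rewrite mpolyXE_id; apply: (big_ind C) => // i _.
  elim: (m i) => [//|t IH]; rewrite exprS; apply: CM => //.
  by exists 1%N; [exact: dhomogXU | rewrite mevalXU expr1].
have Mm m : M (mdeg m) ('X_[m] - 'X_[m].@[v] *: 'X_j ^+ mdeg m).
  have [d hd Md] := CX m; suff -> : mdeg m = d by [].
  by move: hd; rewrite dhomogX => /eqP.
rewrite {2}[f]mpolyE raddf_sum /= scaler_suml [X in X - _]mpolyE -sumrB big_seq.
apply: gmem_sum => m mf; rewrite mevalZ -scalerA -scalerBr; apply: gmemZ.
by move/dhomogP: hf => /(_ _ mf) /= <-.
Qed.

(** Enlarge [I] to an [M] maximal among ideals avoiding the powers of [G]. By [residue_line] all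
    forms of the degree of [G] are proportional to [G] modulo [M], which fixes the ratios of the
    variables and hence a point. *)
Lemma gprime_nullstellensatz I k g : gprime I -> g \is k.-homog -> ~ I k g ->
  exists v : 'I_n.+1 -> K, [/\ exists i, v i != 0,
    forall e f, I e f -> f.@[v] = 0 & g.@[v] != 0].
Proof.
move=> prI hg nIg; have [[i0 nI0] mulI] := prI.
have hG : g * 'X_i0 \is k.+1.-homog.
  by rewrite -[k.+1]addn1; apply: dhomogM => //; apply: dhomogXU.
(* The extra variable makes the degree positive even when [k = 0]. *)
set G := g * 'X_i0 in hG.
have nIG : ~ I k.+1 G.
  by rewrite -[k.+1]addn1 => /(mulI _ _ _ _ hg (dhomogXU _ i0))[].
have [M [IM prM nMG div]] :=
  max_avoiding hG (ltn0Sn k) (fun N => gprime_exp prI hG nIG).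
have nMG1 : ~ M k.+1 G by have := nMG 1%N; rewrite muln1 expr1.
have line a : a \is k.+1.-homog -> exists c, M k.+1 (a - c *: G).
  by move=> ha; apply: residue_line.
have [[j nMj] mulM] := prM.
have hj m : 'X_j ^+ m \is [in K[n.+1], m.-homog].
  by rewrite -{2}[m]mul1n; apply/dhomogMn/dhomogXU.
have nMjX m : ~ M m ('X_j ^+ m).
  by have := gprime_exp (m := m) prM (dhomogXU _ j) nMj; rewrite mul1n.
have [c Mc] := line _ (hj k.+1).
have c0 : c != 0 by apply/eqP => c0; move: Mc; rewrite c0 scale0r subr0; apply: nMjX.
have /choice[v Hv] : forall i, exists vi, M 1%N ('X_i - vi *: 'X_j).
  move=> i; have hi : 'X_i * 'X_j ^+ k \is [in K[n.+1], (k.+1).-homog].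
    by rewrite -[k.+1]add1n; apply: dhomogM => //; apply: dhomogXU.
  (* Both ['X_i * 'X_j ^+ k] and ['X_j ^+ k.+1] are multiples of [G] modulo [M], by [ci] and [c];
     primality then cancels ['X_j ^+ k]. *)
  have [ci Mi] := line _ hi; exists (ci / c).
  have hd : 'X_i - (ci / c) *: 'X_j \is [in K[n.+1], 1.-homog].
    by apply: rpredB; [|apply: rpredZ]; apply: dhomogXU.
  suff Mk : M (1 + k)%N (('X_i - (ci / c) *: 'X_j) * 'X_j ^+ k).
    by have [//|/nMjX] := mulM _ _ _ _ hd (hj k) Mk.
  have -> : ('X_i - (ci / c) *: 'X_j) * 'X_j ^+ k =
      ('X_i * 'X_j ^+ k - ci *: G) - (ci / c) *: ('X_j ^+ k.+1 - c *: G).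
    rewrite scalerBr scalerA divfK // exprS mulrBl -scalerAl.
    by rewrite opprB addrA subrK.
  by rewrite add1n; apply: gmemB => //; apply: gmemZ.
exists v; split.
- exists j; apply/eqP => vj; apply: nMj.
  by have := Hv j; rewrite vj scale0r subr0.
- move=> e f If; apply/eqP/negPn/negP => fv; apply: (nMjX e).
  have Mf := eval_congr Hv (gmem_homog If).
  rewrite -['X_j ^+ e](scalerK fv); apply: gmemZ.
  by have := gmemB (IM _ _ If) Mf; rewrite subKr.
- apply/eqP => gv; have := eval_congr Hv hG.
  by rewrite mevalM gv mul0r scale0r subr0; apply: nMG1.
Qed.

End Nullstellensatz.

(** * Closed sets and their ideals; projective space, points and repeated cuts *)

Section ProjectiveSets.

Variables (K : fieldType) (n : nat).
Local Notation S := {mpoly K[n.+1]}.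
Local Notation PP := (pspace K n).
Implicit Types (I J : gideal K n) (f g : S) (X Y : set PP) (p : PP).

Lemma pspace_vline p : exists v : 'rV[K]_n.+1, v != 0 /\ val p = <[v]>%VS.
Proof.
have /eqP dp := valP p; exists (vpick (val p)).
have v0 : vpick (val p) != 0.
  by rewrite vpick0 -dimv_eq0 dp.
split=> //; apply/esym/eqP; rewrite eqEdim dp dim_vline v0 andbT.
by rewrite -memvE memv_pick.
Qed.

Definition vline_point (v : 'rV[K]_n.+1) (v0 : v != 0) : PP :=
  exist (fun L : {vspace 'rV[K]_n.+1} => \dim L == 1%N) <[v]>%VS
    (introT eqP (etrans (dim_vline v) (congr1 nat_of_bool v0))).

Lemma vanishes_atE e f p (v : 'rV[K]_n.+1) : f \is e.-homog ->
  val p = <[v]>%VS -> vanishes_at f p <-> f.@[v ord0] = 0.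
Proof.
move=> hf ep; split=> [|fv w]; first by apply; rewrite ep memv_line.
rewrite ep => /vlineP[c ->].
rewrite (meval_homog_scale (c := c) (v := v ord0) hf) ?fv ?mulr0 // => i.
by rewrite mxE.
Qed.

Definition zideal X : gideal K n.
Proof.
refine (@GIdeal K n
  (fun e f => f \is e.-homog /\ forall p, X p -> vanishes_at f p) _ _ _ _).
- by move=> e f [].
- by move=> e; split=> [|p _ v _]; rewrite ?dhomog0 ?meval0.
- move=> e c f g [hf Xf] [hg Xg]; split.
    by apply: dhomogD => //; apply: dhomogZ.
  by move=> p Xp v pv; rewrite mevalD mevalZ (Xf p Xp v pv) (Xg p Xp v pv) mulr0 addr0.
- move=> e e' f g hg [hf Xf]; split; first exact: dhomogM.
  by move=> p Xp v pv; rewrite mevalM (Xf p Xp v pv) mulr0.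
Defined.

Definition zset I : set PP := zero_locus [set f | exists e, I e f].

Lemma zset_closed I : zariski_closed (zset I).
Proof. by exists [set f | exists e, I e f] => // f [e /gmem_homog]; exists e. Qed.

Lemma zideal_anti X Y : X `<=` Y -> gsub (zideal Y) (zideal X).
Proof. by move=> XY e f [hf Yf]; split => // p /XY /Yf. Qed.

Lemma zideal_separates X Y : zariski_closed X -> ~ Y `<=` X ->
  exists e f, zideal X e f /\ ~ zideal Y e f.
Proof.
move=> [T hT eX] /existsNP[p /not_implyP[Yp nXp]].
have [f [Tf nf]] : exists f, T f /\ ~ vanishes_at f p.
  apply: contrapT => H; apply: nXp; rewrite eX => f Tf.
  by apply: contrapT => nf; apply: H; exists f.
have [e hf] := hT f Tf; exists e, f; split; last by move=> [_ /(_ p Yp)].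
by split=> // q; rewrite eX => /(_ f Tf).
Qed.

Lemma closed_cut X f : zariski_closed X -> homogeneous f ->
  zariski_closed (X `&` hypersurface f).
Proof.
move=> [T hT ->] hf; exists (T `|` [set f]); first by move=> g [/hT|->].
apply/seteqP; split=> [p [Tp fp] g [Tg|gf]|p Hp]; [exact: Tp|exact: fp|].
by split=> g Hg; apply: Hp; [left|right].
Qed.

(** If [f * g] vanishes on [X], then [X] is the union of its sections by [f] and by [g], so it
    equals one of them. A point of [X] has a nonzero coordinate, which gives a variable outside the
    ideal. *)
Lemma irreducible_gprime X : irreducible_subvariety X -> gprime (zideal X).
Proof.
move=> [cX [p Xp] irr]; split.
  have [v [v0 ep]] := pspace_vline p.
  have [i vi] : exists i, v ord0 i != 0.
    apply: contrapT => H; case/eqP: v0; apply/rowP => i; rewrite !mxE.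
    by apply: contrapT => /eqP vi; apply: H; exists i; rewrite ord1 in vi *.
  exists i => -[h /(_ p Xp)]; rewrite (vanishes_atE h ep) mevalXU.
  exact/eqP.
move=> e e' f g hf hg [hfg Xfg].
have Xfg' : X = (X `&` hypersurface f) `|` (X `&` hypersurface g).
  apply/seteqP; split=> [q Xq|q [] []//].
  have [v [_ eq]] := pspace_vline q.
  have /eqP := (vanishes_atE hfg eq).1 (Xfg q Xq).
  rewrite mevalM mulf_eq0 => /orP[] /eqP H; [left|right]; split=> // _ ->.
    exact: (vanishes_atE hf eq).2.
  exact: (vanishes_atE hg eq).2.
have cf : zariski_closed (X `&` hypersurface f) by apply: closed_cut => //; exists e.
have cg : zariski_closed (X `&` hypersurface g) by apply: closed_cut => //; exists e'.
have [eX|eX] := irr _ _ cf cg Xfg'; [left|right]; split=> // q.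
  by rewrite eX => -[_]; apply.
by rewrite eX => -[_]; apply.
Qed.

Lemma zideal_hilbert_poly X P : hilb_poly (zideal X) P -> is_hilbert_poly X P.
Proof.
move=> [m0 H0]; exists m0 => m lem; exists (hilb (zideal X) m); last exact: H0.
exists (gpiece (zideal X) m) => // f; rewrite mem_gpiece; split=> [[]//|H].
by split=> //; apply: dhomog_is_dhomog.
Qed.

(** Along the chain the ideals are primes that strictly decrease, so by [gproper_poly] the size of
    the Hilbert polynomial grows at each step, starting from at least 1. *)
Lemma irreducible_chain_lt X l P : hilb_poly (zideal X) P ->
  irreducible_chain X l -> (l < size P)%N.
Proof.
move=> HP [W [irrW properW]].
have lt i : (i <= l)%N -> forall Q, hilb_poly (zideal (W i)) Q -> (i < size Q)%N.
  elim: i => [|i IH] il Q HQ.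
    rewrite size_poly_gt0; apply: gprime_poly_neq0 HQ; apply: irreducible_gprime.
    by case: (irrW 0%N il).
  have [Q' HQ'] := hilb_poly_exists (zideal (W i)).
  apply: leq_ltn_trans (IH (ltnW il) Q' HQ') _.
  have [sub nsub] := properW i il.
  apply: gproper_poly HQ HQ'; first by apply: irreducible_gprime; case: (irrW _ il).
  split; first exact: zideal_anti.
  by apply: zideal_separates nsub; case: (irrW i (ltnW il)) => -[].
have [Q HQ] := hilb_poly_exists (zideal (W l)).
apply: leq_trans (lt l (leqnn l) Q HQ) _.
have [_ Wl] := irrW l (leqnn l).
by have [] := hilb_poly_le (zideal_anti Wl) HP HQ.
Qed.

Definition gzero : gideal K n.
Proof.
refine (@GIdeal K n (fun _ f => f = 0) _ _ _ _).
- by move=> e f ->; apply: dhomog0.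
- by [].
- by move=> e c f g -> ->; rewrite scaler0 addr0.
- by move=> e e' f g _ ->; rewrite mulr0.
Defined.

Lemma gprime_gzero : gprime gzero.
Proof.
split; first by exists ord0; apply/eqP/mpolyX_neq0.
by move=> e e' f g _ _ /eqP; rewrite mulf_eq0 => /orP[] /eqP; [left|right].
Qed.

Lemma hdata_gzero : hdata gzero n 1.
Proof.
(* [Q] is [n!] times the binomial [C(X + n, n)], which counts the monomials of degree [X] in [n + 1]
   variables. *)
pose Q : {poly rat} := \prod_(i < n) ('X - (- i.+1%:R)%:P).
have sQ : size Q = n.+1 by rewrite size_prod_XsubC /index_enum -enumT size_enum_ord.
have lQ : lead_coef Q = 1 by apply/monicP/monic_prod_XsubC.
have n0 : n`!%:R != 0 :> rat by rewrite pnatr_eq0 -lt0n fact_gt0.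
exists (n`!%:R^-1 *: Q); split; last by rewrite lead_coefZ lQ mulr1 divff.
  exists 0%N => m _; rewrite hornerZ horner_prod.
  have -> : hilb gzero m = 'C(m + n, n).
    rewrite /hilb; have -> : gpiece gzero m = 0%VS.
      apply/vspaceP => f; rewrite memv0; apply/idP/eqP => [/mem_gpiece f0|->].
        exact/val_inj.
      exact: mem0v.
    by rewrite dimv0 subn0 dimvf -[RHS]bin_sub ?leq_addl // addnK.
  apply: (mulfI n0); rewrite mulrA divff // mul1r -natrM mulnC bin_ffact.
  rewrite ffact_prod natr_prod.
  rewrite [RHS](reindex_inj rev_ord_inj); apply: eq_bigr => i _ /=.
  rewrite hornerXsubC opprK -natrD; congr (_%:R).
  by have := ltn_ord i; lia.
by rewrite size_scale ?invr_eq0.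
Qed.

Section PointIdeal.
Variables (v : 'I_n.+1 -> K) (i0 : 'I_n.+1) (vi0 : v i0 != 0).

Definition gpoint : gideal K n.
Proof.
refine (@GIdeal K n (fun e f => f \is e.-homog /\ f.@[v] = 0) _ _ _ _).
- by move=> e f [].
- by move=> e; rewrite dhomog0 meval0.
- move=> e c f g [hf fv] [hg gv]; split; last first.
    by rewrite mevalD mevalZ fv gv mulr0 addr0.
  by apply: dhomogD => //; apply: dhomogZ.
- by move=> e e' f g hg [hf fv]; split; [exact: dhomogM | rewrite mevalM fv mulr0].
Defined.

Lemma gprime_gpoint : gprime gpoint.
Proof.
split; first by exists i0; rewrite /= mevalXU => -[_ /eqP]; rewrite (negbTE vi0).
move=> e e' f g hf hg [_ /eqP]; rewrite mevalM mulf_eq0.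
by move=> /orP[] /eqP ?; [left|right].
Qed.

Lemma hilb_gpoint m : hilb gpoint m = 1%N.
Proof.
apply/eqP; rewrite eqn_leq (gprime_hilb_gt0 m gprime_gpoint) andbT.
have hx : 'X_i0 ^+ m \is [in K[n.+1], m.-homog].
  by rewrite -{2}[m]mul1n; apply/dhomogMn/dhomogXU.
have ev : ('X_i0 ^+ m : S).@[v] = v i0 ^+ m by rewrite rmorphXn /= mevalXU.
pose x := DHomog hx; rewrite /hilb leq_subLR.
(* Subtracting a multiple of ['X_i0 ^+ m] makes any form vanish at [v], so the piece has codimension
   at most one. *)
have <- : (gpiece gpoint m + <[x]>)%VS = fullv.
  apply/eqP; rewrite eqEsubv subvf; apply/subvP => u _; apply/memv_addP.
  pose c := (val u).@[v] / v i0 ^+ m.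
  exists (u - c *: x); last by exists (c *: x); rewrite ?subrK // memvZ ?memv_line.
  apply/mem_gpiece; split; first exact: dhomog_is_dhomog.
  by rewrite /= mevalB mevalZ ev divfK ?expf_neq0 // subrr.
apply: leq_trans (dimv_add_leqif _ _) _; rewrite leq_add2l dim_vline.
exact: leq_b1.
Qed.

Lemma hdata_gpoint : hdata gpoint 0 1.
Proof.
exists 1; split; rewrite ?size_poly1 ?lead_coef1 ?mulr1 //.
by exists 0%N => m _; rewrite hilb_gpoint hornerC.
Qed.

End PointIdeal.

(** A form already in the prime costs nothing; any other lowers [D] by one and multiplies the degree
    bound by [k]. The bound on [size s] keeps [D] positive whenever a cut is made. *)
Lemma multi_cut k (s : seq S) : (0 < k)%N ->
  (forall g, g \in s -> g \is k.-homog) -> (size s <= n)%N ->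
  exists I D e, [/\ gprime I, hdata I D e, forall g, g \in s -> I k g,
    (n <= D + size s)%N & (e <= k ^ size s)%N].
Proof.
move=> k0; elim: s => [|g s IH] hs sn.
  exists gzero, n, 1%N; split; rewrite ?addn0 //.
    exact: gprime_gzero.
  exact: hdata_gzero.
have [|I [D [e [prI HD HI nD ek]]]] := IH _ (ltnW sn).
  by move=> h hin; apply: hs; rewrite inE hin orbT.
have hg : g \is k.-homog by apply: hs; rewrite mem_head.
have [Ig|nIg] := pselect (I k g).
  exists I, D, e; split=> //.
  - by move=> h; rewrite inE => /predU1P[->|/HI].
  - by rewrite addnS leqW.
  - by apply: leq_trans ek _; rewrite leq_pexp2l.
case: D => [|D] in HD nD; first by move: sn; rewrite /=; lia.
have [J [e' [prJ IJ Jg HJ ee']]] := gprime_cut prI HD k0 hg nIg.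
exists J, D, e'; split=> //.
- by move=> h; rewrite inE => /predU1P[->//|/HI/IJ].
- by rewrite /= addnS -addSn.
- by apply: leq_trans ee' _; rewrite /= expnS leq_mul2l ek orbT.
Qed.

End ProjectiveSets.

(** * From primes to varieties: irreducibility, dimension, degree *)

Section Varieties.

Variables (K : closedFieldType) (n : nat).
Local Notation S := {mpoly K[n.+1]}.
Implicit Types (I J : gideal K n) (f g : S).
Hypothesis fibK : infinite_fibers K.

Lemma zideal_zset I : gprime I -> gsub (zideal (zset I)) I.
Proof.
move=> prI e f [hf Zf]; apply: contrapT => nIf.
have [v [[i vi] Iv /eqP fv]] := gprime_nullstellensatz fibK prI hf nIf.
pose w := \row_i v i; have w0 : w != 0.
  by apply: contraNneq vi => /rowP/(_ i); rewrite !mxE => ->.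
have ew g : g.@[w ord0] = g.@[v] by apply: meval_eq => j; rewrite mxE.
apply: fv; rewrite -ew; apply: (vanishes_atE (p := vline_point w0) hf _).1 => //.
apply: Zf => g [d Ig].
by apply: (vanishes_atE (v := w) (gmem_homog Ig) _).2 => //; rewrite ew; apply: Iv Ig.
Qed.

Lemma gsub_zideal_zset I : gsub I (zideal (zset I)).
Proof.
move=> e f If; split; first exact: gmem_homog If.
by move=> p; apply; exists e.
Qed.

(** If both parts of a decomposition were proper, each would have a form vanishing on it but not on
    the whole; their product lies in [I] by the Nullstellensatz, against primality. *)
Lemma zset_irreducible I : gprime I -> irreducible_subvariety (zset I).
Proof.
move=> prI; have [[i nIi] mulI] := prI; split; first exact: zset_closed.
  apply: contrapT => /forallNP nZ; apply: nIi; apply: (zideal_zset prI).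
  by split=> [|p /nZ//]; apply: dhomogXU.
move=> A B cA cB eAB; apply: contrapT => /not_orP[nA nB].
have AX : A `<=` zset I by move=> p Ap; rewrite eAB; left.
have BX : B `<=` zset I by move=> p Bp; rewrite eAB; right.
have [e [f [Af nf]]] : exists e f, zideal A e f /\ ~ zideal (zset I) e f.
  by apply: zideal_separates => // XA; apply: nA; apply/seteqP.
have [e' [g [Bg ng]]] : exists e f, zideal B e f /\ ~ zideal (zset I) e f.
  by apply: zideal_separates => // XB; apply: nB; apply/seteqP.
have [hf Af'] := Af; have [hg Bg'] := Bg.
have Ifg : I (e + e')%N (f * g).
  apply: (zideal_zset prI); split; first exact: dhomogM.
  move=> p; rewrite eAB => -[/Af' fp|/Bg' gp] v pv; rewrite mevalM.
    by rewrite fp ?mul0r.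
  by rewrite gp ?mulr0.
by have [/gsub_zideal_zset|/gsub_zideal_zset] := mulI _ _ _ _ hf hg Ifg.
Qed.

Lemma hilb_poly_zset I P : gprime I -> hilb_poly I P -> hilb_poly (zideal (zset I)) P.
Proof.
move=> prI [m0 H0]; exists m0 => m /H0 ->; congr (_%:R).
apply/eqP; rewrite eqn_leq !hilb_le //; last exact: zideal_zset.
exact: gsub_zideal_zset.
Qed.

(** A cut by a variable outside [I] gives a prime with [D] one lower; its chain is prolonged by
    [zset I] on top, strictly since that variable does not vanish on [zset I]. *)
Lemma zset_chain I D e : gprime I -> hdata I D e -> irreducible_chain (zset I) D.
Proof.
elim: D I e => [|D IH] I e prI HI.
  by exists (fun=> zset I); split=> // i _; split=> //; apply: zset_irreducible.
have [[i nIi] _] := prI.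
have [J [e' [prJ IJ Jx HJ _]]] := gprime_cut prI HI (ltn0Sn 0) (dhomogXU K i) nIi.
have JI : zset J `<=` zset I by move=> p Jp f [d /IJ Jf]; apply: Jp; exists d.
have [W [irrW properW]] := IH J e' prJ HJ.
exists (fun j => if (j <= D)%N then W j else zset I); split=> j jD.
  case: ifP => [/irrW[? Wj]|_]; split=> //; first exact: subset_trans Wj JI.
  exact: zset_irreducible.
rewrite -ltnS jD; case: ltnP => [jD'|]; first exact: properW.
move=> Dj; have -> : j = D by apply/eqP; rewrite eqn_leq -ltnS jD.
have [_ WJ] := irrW D (leqnn D); split; first exact: subset_trans WJ JI.
move=> IW; apply: nIi; apply: (zideal_zset prI); split; first exact: dhomogXU.
by move=> p /IW/WJ; apply; exists 1%N.
Qed.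

Lemma zset_dim I D e : gprime I -> hdata I D e -> is_dim (zset I) D.
Proof.
move=> prI HI; split; first exact: zset_chain HI.
have [P [HP sP _]] := HI; move=> m /(irreducible_chain_lt (hilb_poly_zset prI HP)).
by rewrite sP ltnS.
Qed.

Lemma zset_degree I D e : gprime I -> hdata I D e -> is_degree (zset I) e.
Proof.
move=> prI HI; have [P [HP sP eP]] := HI; exists D, P; split=> //.
  exact: zset_dim HI.
exact/zideal_hilbert_poly/hilb_poly_zset.
Qed.

Lemma small_subvariety d c s k r (F : S) (G H : 'I_r -> S) :
  (0 < n)%N -> F \is d.-homog -> (0 < k)%N -> (forall i, G i \is k.-homog) ->
  F = \sum_(i < r) G i * H i -> (r <= c)%N -> (k ^ r < s)%N ->
  exists (X : set (pspace K n)) (a e : nat),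
    [/\ irreducible_subvariety X, X `<=` hypersurface F,
        is_codim X a /\ (a <= c)%N & is_degree X e /\ (e < s)%N].
Proof.
move=> n0 hF k0 hG eF rc ks.
suff [I [D [e [prI HI XF nDc es]]]] : exists I D e, [/\ gprime I, hdata I D e,
    zset I `<=` hypersurface F, (n - D <= c)%N & (e < s)%N].
  exists (zset I), (n - D)%N, e; split=> //.
  - exact: zset_irreducible.
  - by split=> //; exists D => //; apply: zset_dim HI.
  - by split=> //; apply: zset_degree HI.
have [rn|nr] := leqP r n.
  have [|| I [D [e [prI HI IG nD ek]]]] := @multi_cut K n k (codom G) k0.
  - by move=> _ /codomP[i ->].
  - by rewrite size_codom card_ord.
  rewrite size_codom card_ord in nD ek.
  exists I, D, e; split=> //; [|by lia|by apply: leq_ltn_trans ek _].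
  move=> p Zp _ -> v pv; rewrite eF raddf_sum big1 // => i _ /=.
  rewrite mevalM (Zp (G i) _ v pv) ?mul0r //.
  by exists k; apply/IG/codom_f.
(* With more than [n] forms, a point of [Z(F)] has codimension [n], below [r], and degree 1; it is
   found as a zero of some prime containing [F]. *)
have [J [prJ JF]] : exists J, gprime J /\ J d F.
  have [F0|/eqP F0] := pselect (F = 0).
    by exists (gzero K n); rewrite F0; split; [exact: gprime_gzero | exact: gmem0].
  case: d hF => [|d] hF.
    (* A constant [F] equals its value at the origin, which is zero because every [G i] has positive
       degree. *)
    case/eqP: F0; apply: (@zideal_zset (gzero K n) (gprime_gzero K n) 0%N).
    split=> // p _ v _.
    have ev (f : S) e : f \is e.-homog -> f.@[fun=> 0] = 0 ^+ e * f.@[v ord0].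
      by move=> hf; apply: (meval_homog_scale hf) => i; rewrite mul0r.
    have := ev _ _ hF; rewrite expr0 mul1r => <-.
    rewrite eF raddf_sum big1 // => i _ /=.
    by rewrite mevalM (ev _ _ (hG i)) expr0n gtn_eqF // !mul0r.
  have HZ := hdata_gzero K n; rewrite -[X in hdata _ X](prednK n0) in HZ.
  have [J [e' [prJ _ JF _ _]]] :=
    gprime_cut (gprime_gzero K n) HZ (ltn0Sn d) hF (fun h => elimN eqP F0 h).
  by exists J.
have [[i nJi] _] := prJ.
have [v [_ Jv vi]] := gprime_nullstellensatz fibK prJ (dhomogXU K i) nJi.
rewrite mevalXU in vi.
exists (gpoint v), 0%N, 1%N; split.
- exact: gprime_gpoint vi.
- exact: hdata_gpoint vi.
- by move=> p Zp _ ->; apply: Zp; exists d; split=> //; apply: Jv JF.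
- by rewrite subn0 (leq_trans (ltnW nr) rc).
- by apply: leq_trans ks; rewrite ltnS expn_gt0 k0.
Qed.

End Varieties.

(** * Uncountability of the real and complex numbers *)

Section ComplexFibers.

Variable R : realType.

Lemma avoiding_subinterval (s : seq R) (a b : R) : a < b ->
  exists a' b', [/\ a <= a', a' < b', b' <= b &
    forall x, x \in s -> ~~ (a' <= x <= b')].
Proof.
elim: s a b => [|y s IH] a b ab; first by exists a, b; rewrite !lexx.
have [a1 [b1 [aa1 ab1 bb1 Hy]]] : exists a1 b1,
    [/\ a <= a1, a1 < b1, b1 <= b & ~~ (a1 <= y <= b1)].
  have [lt|ge] := ltP y ((a + b) / 2).
    by exists ((a + b) / 2), b; split; lra.
  by exists a, ((a + (a + b) / 2) / 2); split; lra.
have [a' [b' [? ? ? H]]] := IH _ _ ab1.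
exists a', b'; split=> //; try lra.
move=> x; rewrite inE => /predU1P[->|/H//].
by apply: contra Hy => /andP[? ?]; apply/andP; split; lra.
Qed.

(* Nested intervals: the m-th one avoids the fibre {N <= m}. *)
Lemma infinite_fibers_real : infinite_fibers R.
Proof.
move=> N; apply: contrapT => /forallNP H.
have /choice[s Hs] : forall m, exists s : seq R, forall c, (N c <= m)%N -> c \in s.
  move=> m; apply: contrapT => /forallNP nH; apply: (H m) => s.
  have /existsNP[c /not_implyP[? /negP ?]] := nH s.
  by exists c.
have /choice[step Hstep] : forall mab : nat * (R * R), exists ab : R * R,
    mab.2.1 < mab.2.2 -> [/\ mab.2.1 <= ab.1, ab.1 < ab.2, ab.2 <= mab.2.2 &
      forall x, x \in s mab.1 -> ~~ (ab.1 <= x <= ab.2)].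
  move=> [m [a b]] /=; have [ab|_] := boolP (a < b); last by exists (a, b).
  by have [a' [b' ?]] := avoiding_subinterval (s m) ab; exists (a', b').
pose u := fix u m := if m is m'.+1 then step (m', u m') else (0 : R, 1 : R).
have lt m : (u m).1 < (u m).2.
  by elim: m => [|m IH] /=; [exact: ltr01 | case: (Hstep (m, u m) IH)].
have le1 m m' : (m <= m')%N -> (u m).1 <= (u m').1.
  move=> /subnK <-; elim: (m' - m)%N => [//|j IH]; apply: le_trans IH _.
  by case: (Hstep (j + m, u (j + m))%N (lt _)).
have le2 m m' : (m <= m')%N -> (u m').2 <= (u m).2.
  move=> /subnK <-; elim: (m' - m)%N => [//|j IH]; apply: le_trans IH.
  by case: (Hstep (j + m, u (j + m))%N (lt _)).
pose A := range (fun m => (u m).1).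
have ubA m : ubound A (u m).2.
  move=> _ [m' _ <-]; have [mm|mm] := leqP m m'.
    by apply: ltW; apply: lt_le_trans (lt m') (le2 _ _ mm).
  by apply: ltW; apply: le_lt_trans (le1 _ _ (ltnW mm)) (lt m).
have supA : has_sup A by split; [exists (u 0%N).1, 0%N | exists (u 0%N).2].
pose x := sup A.
have xin m : (u m).1 <= x <= (u m).2.
  apply/andP; split; first by apply: (sup_upper_bound supA); exists m.
  by apply: ge_sup => //; exact: (proj1 supA).
(* The common point [x] lies in the very interval built to avoid the fibre that contains it. *)
have [_ _ _] := Hstep (N x, u (N x)) (lt _).
by move=> /(_ x (Hs _ _ (leqnn _))); rewrite (xin (N x).+1).
Qed.

(** Restrict [N] to the real line and avoid the real parts of the elements of [s]. *)
Lemma infinite_fibers_complex : infinite_fibers R[i].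
Proof.
move=> N; have [m Hm] := infinite_fibers_real (fun x => N x%:C%C).
exists m => s; have [x xs Nx] := Hm (map (@complex.Re R) s).
exists x%:C%C => //; apply: contra xs => xs; apply/mapP.
by exists x%:C%C.
Qed.

End ComplexFibers.

(** * Lower bounds for slice rank and strength *)

Theorem theorem14 (R : realType) (n d c s : nat) (F : {mpoly R[i][n.+1]})
    (hn : (1 <= n)%N) (hF : F \is d.-homog) (hs : (2 <= s)%N)
    (hX : ~ exists (X : set (pspace R[i] n)) (a e : nat),
        [/\ irreducible_subvariety X, X `<=` hypersurface F,
            is_codim X a /\ (a <= c)%N & is_degree X e /\ (e < s)%N]) :
  (forall r : nat, is_slice_rank F r -> (c + 1 <= r)%N) /\
  (forall k : nat, (2 <= k)%N -> (k <= d - 1)%N ->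
     forall r : nat, is_strength d k F r ->
       (minn (c + 1) (up_log k s) <= r)%N).
Proof.
split=> [r [[L [H [hL _ eF]]] _]|k k2 _ r [[G [H [hG _ eF]]] _]].
  rewrite addn1 ltnNge; apply/negP => rc; apply: hX.
  (* Slice rank is the case [k = 1], where the degree bound [k ^ r] is 1 and only the codimension
     matters. *)
  have ks : (1 ^ r < s)%N by rewrite exp1n.
  exact: (small_subvariety (@infinite_fibers_complex R) hn hF (ltn0Sn 0) hL eF rc ks).
rewrite leqNgt leq_min addn1 ltnS; apply/negP => /andP[rc rlog]; apply: hX.
have ks : (k ^ r < s)%N.
  by rewrite ltnNge; apply/negP => /(up_log_min k2); rewrite leqNgt rlog.
exact: (small_subvariety (@infinite_fibers_complex R) hn hF (ltnW k2) hG eF rc ks).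
Qed.
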